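(* Let $0<\alpha<1$ and $A=-\log(1-\alpha)$. Let $\{L(t),t\ge 0\}$ be the Lévy process generated by the infinitely divisible logarithmic series distribution $$P(L(1)=k)=\frac{1}{A}\,\frac{\alpha^{k+1}}{k+1},\qquad k=0,1,2,\ldots .$$ Let $G(s)=\sum_{k=1}^{\infty}\frac{(\alpha s)^k}{k+1}$ for $|s|\le 1$, so that ${}_2F_1(1,1;2;\alpha s)=1+G(s)$. Then: (1) The Lévy measure of the process $L(t)$ is given, for $n=1,2,\ldots$, by $$\Pi_L(n)=\frac{\alpha^n}{n!}\sum_{k=1}^{n}(-1)^{k-1}(k-1)!\,B_{n,k}(c_\bullet),\qquad c_k=\frac{k!}{k+1}.$$ (2) The generating function $Q_L(s)=\sum_{n=1}^\infty s^n\,\Pi_L(n)$ of the Lévy measure is $$Q_L(s)=\log(1+G(s)),\qquad |s|\le 1 .$$ (3) The Bernstein function of $L(t)$ is $$\psi_L(\lambda)=\theta_L\left\{1-\frac{1}{\theta_L}\log\bigl(1+G(e^{-\lambda})\bigr)\right\},\qquad\lambda\ge 0,$$ where $$\theta_L=\psi_L(\infty)=-\log\left(\frac{\alpha}{A}\right).$$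
   Context: A Lévy process here has stationary independent increments and starts at $0$; its law is determined by the (infinitely divisible) law of its value at time $1$. The logarithmic series distribution on $\{0,1,2,\ldots\}$ displayed in the claim is known to be infinitely divisible. The Bernstein function (Laplace exponent) $\psi_L$ is defined by $E[e^{-\lambda L(t)}]=\exp(-t\psi_L(\lambda))$, $\lambda\ge 0$, and $\psi_L(\infty)=\lim_{\lambda\to\infty}\psi_L(\lambda)$. The Lévy measure is the sequence $\Pi_L(n)\ge 0$, $n=1,2,\ldots$, such that $\psi_L(\lambda)=\sum_{n\ge1}(1-e^{-\lambda n})\Pi_L(n)$ for all $\lambda\ge 0$; its total mass is $\theta_L=\sum_{n\ge1}\Pi_L(n)$. The Gauss hypergeometric function satisfies ${}_2F_1(1,1;2;z)=\sum_{k\ge0}\frac{z^k}{k+1}=\frac{-\log(1-z)}{z}$ for $|z|<1$. The logarithm is the principal branch. Partial Bell polynomials: for a sequence $x_\bullet=(x_1,x_2,\ldots)$ and $1\le k\le n$, $$B_{n,k}(x_\bullet)=\sum \frac{n!\,x_1^{k_1}\cdots x_n^{k_n}}{k_1!(1!)^{k_1}\cdots k_n!(n!)^{k_n}},$$ the sum running over all nonnegative integer solutions $(k_1,\ldots,k_n)$ of $k_1+2k_2+\cdots+nk_n=n$, $k_1+\cdots+k_n=k$. *)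

(* Defs.v *)
(* MathComp-Analysis; the complex numbers are R[i] over an abstract R : realType. *)
From HB Require Import structures.
From mathcomp Require Import all_boot all_order all_algebra.
From mathcomp Require Import all_classical all_reals all_analysis.
From mathcomp Require Import complex.

Set Implicit Arguments.
Unset Strict Implicit.
Unset Printing Implicit Defensive.

Import Order.TTheory GRing.Theory Num.Theory.
Import numFieldNormedType.Exports.

Local Open Scope classical_set_scope.
Local Open Scope ring_scope.

Section LevyProcesses.
Context {d : measure_display} {T : measurableType d} {R : realType}.
Variable P : probability T R.

(* Mutual independence of a finite family. The product rule for subfamilies is
   the case where some of the B i are setT. *)
Definition mutually_independent n (X : 'I_n -> T -> R) : Prop :=
  forall B : 'I_n -> set R, (forall i, measurable (B i)) ->
    fine (P (\bigcap_(i in [set: 'I_n]) (X i @^-1` B i))) =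
    \prod_(i < n) fine (P (X i @^-1` B i)).

(* The process is indexed by R, but only times t >= 0 are constrained or used.
   Without stochastic continuity the law of X 1 would not determine the law of
   the process (add a discontinuous additive function of t that vanishes at 1).
   Cadlag paths are not required. *)
Record levy_process (X : R -> {RV P >-> R}) : Prop := LevyProcess {
  levy_start : {ae P, forall w, X 0 w = 0};
  levy_independent_increments : forall (n : nat) (t : nat -> R),
    0 <= t 0%N -> {homo t : i j / (i <= j)%N >-> i <= j} ->
    mutually_independent (fun (i : 'I_n) w => X (t i.+1) w - X (t i) w);
  levy_stationary_increments : forall s t : R, 0 <= s -> 0 <= t ->
    forall B : set R, measurable B ->
    P ((fun w => X (s + t) w - X s w) @^-1` B) = P (X t @^-1` B);
  levy_stochastic_continuity : forall t e : R, 0 <= t -> 0 < e ->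
    P [set w | e < `|X s w - X t w|] @[s --> within [set s | 0 <= s] (nbhs t)]
      --> 0%E
}.

Definition laplace_exponent (X : R -> {RV P >-> R}) (psi : R -> R) : Prop :=
  forall t lambda : R, 0 <= t -> 0 <= lambda ->
    'E_P[fun w => expR (- (lambda * X t w))]%E = (expR (- (t * psi lambda)))%:E.

End LevyProcesses.

Section LevyMeasure.
Context {R : realType}.

(* A measure on {1, 2, ...}, given by its masses; Pi 0 is never used. *)
Definition levy_measure (psi : R -> R) (Pi : nat -> R) : Prop :=
  (forall n, (1 <= n)%N -> 0 <= Pi n) /\
  (forall lambda : R, 0 <= lambda ->
    (psi lambda)%:E =
    (\sum_(1 <= n <oo) ((1 - expR (- (lambda * n%:R))) * Pi n)%:E)%E).

Definition total_mass (Pi : nat -> R) : \bar R :=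
  (\sum_(1 <= n <oo) (Pi n)%:E)%E.

End LevyMeasure.

Section Series.
Context {K : numFieldType}.

Definition pochhammer (a : K) (n : nat) : K := \prod_(i < n) (a + i%:R).

Definition hypergeometric2F1 (a b c z : K) : K :=
  limn (series (fun n => pochhammer a n * pochhammer b n / pochhammer c n
                         * (z ^+ n / n`!%:R))).

(* sum over k >= 1 of (alpha s)^k / (k + 1), reindexed from k = 0 *)
Definition G (alpha s : K) : K :=
  limn (series (fun k => (alpha * s) ^+ k.+1 / k.+2%:R)).

(* The k_i solving k_1 + 2 k_2 + ... + n k_n = n are at most n, so each ranges
   over 'I_n.+1; i : 'I_n stands for the index i + 1. x 0 is not used. *)
Definition partial_bell (n k : nat) (x : nat -> K) : K :=
  \sum_(m : {ffun 'I_n -> 'I_n.+1} |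
         ((\sum_(i < n) i.+1 * m i)%N == n) && ((\sum_(i < n) m i)%N == k))
    (n`!%:R * \prod_(i < n) x i.+1 ^+ m i)
    / \prod_(i < n) ((m i)`!%:R * (i.+1)`!%:R ^+ m i).

End Series.

Section ComplexFunctions.
Context {R : realType}.
Local Open Scope complex_scope.

(* principal argument, in ]-pi, pi]; meaningful for z != 0 *)
Definition Carg (z : R[i]) : R :=
  let r := acos (complex.Re z / ComplexField.Normc.normc z) in
  if 0 <= complex.Im z then r else - r.

(* principal branch; meaningful for z != 0 *)
Definition Clog (z : R[i]) : R[i] := ln (ComplexField.Normc.normc z) +i* Carg z.

Definition gen_terms (Pi : nat -> R) (s : R[i]) : nat -> (R[i] : numFieldType) :=
  fun n => s ^+ n.+1 * (Pi n.+1)%:C.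

Definition gen_function (Pi : nat -> R) (s : R[i]) : R[i] :=
  limn (series (gen_terms Pi s)).

End ComplexFunctions.

(* Main.v *)
(* Put z = alpha s.  The generating function of L(1) is, up to a constant,
   F(z) = \sum_n z^n / (n+1), and the Bell polynomial formula says exactly that
   Pi_L(n) is alpha^n times the n-th coefficient of the formal logarithm of F,
   so that F' = R F with R the derivative of that logarithm.  Kaluza's argument
   for log-convex sequences gives 1/F = 1 - \sum_n b_n z^n with b_n >= 0 and
   \sum_n b_n <= 1, and that the coefficients of R lie in [0, 1].  The former
   yields Re F > 0 on the open unit disc, so that integrating F' = R F along a
   ray identifies the formal logarithm with the principal one.  On the
   probabilistic side t |-> E e^(-lambda L(t)) is multiplicative, and stochastic
   continuity bounds it from below near 0, hence it is an exponential; a power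
   series argument shows that the Levy measure is unique. *)
Require Import Defs.
From HB Require Import structures.
From mathcomp Require Import all_boot all_order all_algebra.
From mathcomp Require Import all_classical all_reals all_analysis.
From mathcomp Require Import complex.
From mathcomp Require Import measurable_realfun ring lra zify.

Set Implicit Arguments.
Unset Strict Implicit.
Unset Printing Implicit Defensive.

Import Order.TTheory GRing.Theory Num.Theory.
Import numFieldNormedType.Exports.

Local Open Scope classical_set_scope.
Local Open Scope complex_scope.
Local Open Scope ring_scope.

Local Notation normc := ComplexField.Normc.normc.

(** Signs are the obstacle: the alternating Bell sum does not show that the masses are nonnegative,
    and the series F does not show that its real part is positive. Both facts are read off
    convolution identities, where log-convexity of 1/(n+1) applies. The boundary |s| = 1 is
    harmless: alpha < 1 keeps z = alpha s inside the open unit disc, where coefficients bounded by 1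
    already give geometric convergence. Hence the only analytic input is that the coefficients of F,
    of its logarithm and of 1/F, and those of the derivatives that occur, are bounded. Complex sums
    are handled as pairs of real power series in t along the ray t z with 0 <= t <= 1, so that real
    derivatives and the intermediate value theorem suffice. Only the law of L(1) is given. At other
    times L(t) might a priori be negative with an infinite Laplace transform, so the transform stays
    an extended real until its finiteness is derived from the integer times. *)

Definition conv (K : pzRingType) (a b : nat -> K) (n : nat) : K :=
  \sum_(k < n.+1) a k * b (n - k)%N.

(** * Bell polynomials and the formal logarithm *)

Section BellLog.
Variable K : numFieldType.
Implicit Types (x g h : {poly K}) (p : nat -> K).

Let factN0 n : n`!%:R != 0 :> K.
Proof. by rewrite pnatr_eq0 -lt0n fact_gt0. Qed.

(** The exponential series of [x] times an auxiliary variable. The outer variable will count the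
    factors taken, the inner one their total weight. *)
Definition truncated_exp N x : {poly {poly K}} :=
  \poly_(j < N) (j`!%:R^-1 *: x ^+ j).

Lemma coef_prod_truncated_exp (I : Type) (r : seq I) (x : I -> {poly K}) N k :
  (k < N)%N ->
  (\prod_(i <- r) truncated_exp N (x i))`_k
  = k`!%:R^-1 *: (\sum_(i <- r) x i) ^+ k.
Proof.
elim: r k => [|i r IHr] k kN.
  rewrite !big_nil coef1; case: k {kN} => [|k] /=.
    by rewrite expr0 fact0 invr1 scale1r.
  by rewrite expr0n scaler0.
rewrite !big_cons coefMr exprDn scaler_sumr; apply: eq_bigr => j _.
have jk : (j <= k)%N by rewrite -ltnS.
rewrite IHr ?(leq_ltn_trans jk)// coef_poly (leq_ltn_trans (leq_subr _ _) kN).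
rewrite -scalerAl -scalerAr [LHS]scalerA -(scaler_nat 'C(k, j)) [RHS]scalerA.
congr (_ *: _); rewrite -(bin_fact jk) !natrM.
by field; rewrite !factN0 pnatr_eq0 -lt0n bin_gt0 jk.
Qed.

(** Both sides are the coefficient of y^k in the product of the exp(x_i y): as exp(y times the sum)
    on the left, distributed on the right. The bound [k < N] makes the truncation harmless and lets
    the exponents range over ['I_N], as in [partial_bell]. *)
Lemma multinomial n (x : 'I_n -> {poly K}) N k : (k < N)%N ->
  k`!%:R^-1 *: (\sum_(i < n) x i) ^+ k =
  \sum_(m : {ffun 'I_n -> 'I_N} | (\sum_(i < n) m i)%N == k)
    \prod_(i < n) ((m i)`!%:R^-1 *: x i ^+ m i).
Proof.
move=> kN; rewrite -(coef_prod_truncated_exp _ _ kN).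
under eq_bigr do rewrite /truncated_exp poly_def.
rewrite bigA_distr_bigA/= coef_sum [RHS]big_mkcond/=; apply: eq_bigr => m _.
rewrite scaler_prod coefZ -expr_sum coefXn eq_sym.
by case: eqP => _; rewrite ?mulr1 ?mulr0.
Qed.

(** With arguments j! p_j the powers of j! in the Bell polynomial cancel and the multinomial weights
    remain. The constraint on the number of parts is the multinomial one; the constraint on the
    weight is the extraction of the coefficient of degree [n]. *)
Lemma partial_bellE n k p : (k <= n)%N ->
  partial_bell n k (fun j => j`!%:R * p j) =
  n`!%:R / k`!%:R * ((\sum_(i < n) p i.+1 *: 'X^(i.+1)) ^+ k)`_n.
Proof.
move=> kn.
have prodE (m : {ffun 'I_n -> 'I_n.+1}) :
    \prod_(i < n) ((m i)`!%:R^-1 *: (p i.+1 *: 'X^(i.+1)) ^+ m i) =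
    (\prod_(i < n) ((m i)`!%:R^-1 * p i.+1 ^+ m i)) *:
      'X^(\sum_(i < n) i.+1 * m i).
  under eq_bigr do rewrite exprZn -exprM scalerA.
  by rewrite scaler_prod -expr_sum.
rewrite -mulrA -coefZ (@multinomial n _ n.+1)// coef_sum mulr_sumr.
rewrite /partial_bell [RHS](bigID (fun m : {ffun 'I_n -> 'I_n.+1} =>
  (\sum_(i < n) i.+1 * m i)%N == n))/= [X in _ = _ + X]big1 => [|m /andP[_ mn]].
  rewrite addr0; apply: eq_big => [m|m /andP[/eqP mn _]]; first by rewrite andbC.
  rewrite prodE coefZ mn coefXn eqxx mulr1 -mulrA; congr (_ * _).
  rewrite -prodf_div; apply: eq_bigr => i _; rewrite exprMn.
  by field; rewrite factN0 expf_neq0.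
by rewrite prodE coefZ coefXn eq_sym (negPf mn) !mulr0.
Qed.

Let scale_sign_exp g h k : (-1) ^+ k *: (g * h ^+ k) = g * (- h) ^+ k.
Proof.
elim: k => [|k IHk] in g *; first by rewrite !expr0 scale1r.
by rewrite !exprS mulN1r scaleNr [g * (h * _)]mulrA IHk mulNr mulrN -mulrA.
Qed.

Lemma coef_exp_congr g h n k :
  (forall i, (i <= n)%N -> g`_i = h`_i) ->
  forall i, (i <= n)%N -> (g ^+ k)`_i = (h ^+ k)`_i.
Proof.
move=> gh; elim: k => [//|k IHk] i ni; rewrite !exprS !coefM.
apply: eq_bigr => j _; have ji : (j <= i)%N by rewrite -ltnS.
by rewrite gh ?(leq_trans ji)// IHk// (leq_trans (leq_subr _ _)).
Qed.

Lemma coef_exp_lt g k n : g`_0 = 0 -> (n < k)%N -> (g ^+ k)`_n = 0.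
Proof.
move=> g0; elim: k n => [//|k IHk] n nk; rewrite exprS coefM big1// => j _.
case: j => -[|j]/= jn; first by rewrite g0 mul0r.
by rewrite IHk ?mulr0//; lia.
Qed.

(* The coefficient of x^n in log (1 + \sum_(k >= 1) p k x^k). *)
Definition log_coef p (n : nat) : K :=
  n`!%:R^-1 * \sum_(1 <= k < n.+1)
    (-1) ^+ k.-1 * (k.-1)`!%:R * partial_bell n k (fun j => j`!%:R * p j).

Let trunc p N : {poly K} := \sum_(i < N) p i.+1 *: 'X^(i.+1).

Let coef_trunc p N i : (i < N)%N -> (trunc p N)`_i.+1 = p i.+1.
Proof.
move=> iN; rewrite coef_sum (bigD1 (Ordinal iN))//= coefZ coefXn eqxx mulr1.
rewrite big1 ?addr0// => j; rewrite -val_eqE/= => ji.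
by rewrite coefZ coefXn eqSS eq_sym (negPf ji) mulr0.
Qed.

Let coef_trunc0 p N : (trunc p N)`_0 = 0.
Proof. by rewrite coef_sum big1// => i _; rewrite coefZ coefXn mulr0. Qed.

Let truncated_log p N : {poly K} :=
  \sum_(k < N) ((-1) ^+ k / k.+1%:R) *: trunc p N ^+ k.+1.

(** The result does not depend on [N]: powers of the truncation beyond the [n.+1]-th have no term of
    degree [n.+1], and in the lower powers only the coefficients of [p] up to [n.+1] matter. *)
Let coef_truncated_log p N n : (n < N)%N ->
  (truncated_log p N)`_n.+1 = log_coef p n.+1.
Proof.
move=> nN; rewrite /truncated_log coef_sum (bigID (fun k : 'I_N => (k < n.+1)%N))/=.
rewrite addrC big1 ?add0r => [|k kn]; last first.
  by rewrite coefZ coef_exp_lt ?mulr0 ?coef_trunc0// ltnS ltnNge -ltnS.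
rewrite /log_coef big_add1/= big_mkord (big_ord_widen_cond N xpredT
  (fun k => (-1) ^+ k * k`!%:R * partial_bell n.+1 k.+1 (fun j => j`!%:R * p j)))//.
rewrite mulr_sumr; apply: eq_bigr => k kn.
rewrite coefZ partial_bellE// (@coef_exp_congr (trunc p N) (trunc p n.+1) n.+1)//.
  rewrite -/(trunc _ _) [k.+1`!]factS natrM; field.
  by rewrite !factN0 nat1r pnatr_eq0.
by case=> [|i] ni; rewrite ?coef_trunc0// !coef_trunc// (leq_trans ni).
Qed.

(** Coefficientwise form of (log f)' f = f'. The derivative of the cut logarithm is g' times a
    finite geometric sum in -g; multiplied by 1 + g it becomes g' - g' (-g)^N, and N = n + 1 puts
    the error beyond degree n. *)
Lemma log_coef_rec p n : p 0%N = 1 ->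
  conv (fun k => k.+1%:R * log_coef p k.+1) p n = n.+1%:R * p n.+1.
Proof.
move=> p0; pose N := n.+1; pose g := trunc p N.
have dlog : (truncated_log p N)^`() * (1 + g) = g^`() - g^`() * (- g) ^+ N.
  have -> : (truncated_log p N)^`() = g^`() * \sum_(k < N) (- g) ^+ k.
    rewrite /truncated_log raddf_sum/= mulr_sumr; apply: eq_bigr => k _.
    rewrite derivZ deriv_exp/= -[X in _ *: X](scaler_nat k.+1) [LHS]scalerA divfK ?pnatr_eq0//.
  have -> : 1 + g = - (- g - 1) by rewrite opprB opprK.
  by rewrite -mulrA mulrN [_ * (- g - 1)]mulrC -subrX1 opprB mulrBr mulr1.
transitivity (((truncated_log p N)^`() * (1 + g))`_n).
  rewrite coefM; apply: eq_bigr => k _; have kn : (k <= n)%N by rewrite -ltnS.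
  rewrite coef_deriv coef_truncated_log// mulr_natl; congr (_ * _).
  rewrite coefD coef1; case E : (n - k)%N => [|j].
    by rewrite coef_trunc0 addr0.
  by rewrite add0r coef_trunc// ltnW// ltnS -E leq_subr.
rewrite dlog coefB coef_deriv coef_trunc// mulr_natl.
rewrite coefM big1 ?subr0// => j _; rewrite coef_exp_lt ?mulr0//.
  by rewrite coefN coef_trunc0 oppr0.
by rewrite ltnS leq_subr.
Qed.

End BellLog.

(** * Signs and bounds in convolution equations *)

Section Deconvolution.
Variable R : realFieldType.
Implicit Types a p q : nat -> R.

(* Kaluza's argument: the ratios [p n.+1 / p n] increase, so the defect of the
   recursion at rank [n.+1] is at least [q n.+1 - q n * (p n.+1 / p n)]. *)
Lemma deconv_ge0 a p q :
  p 0%N = 1 -> (forall n, 0 < p n) ->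
  (forall k n, (k <= n)%N -> p k.+1 * p n <= p n.+1 * p k) ->
  0 <= q 0%N -> (forall n, q n * p n.+1 <= q n.+1 * p n) ->
  (forall n, conv a p n = q n) -> forall n, 0 <= a n.
Proof.
move=> p0 pgt0 lc q0 qp apq n; elim/ltn_ind: n => -[|n] IHn.
  by have := apq 0%N; rewrite /conv big_ord1 p0 mulr1 => ->.
have := apq n.+1; rewrite /conv big_ord_recr/= subnn p0 mulr1 => E.
have -> : a n.+1 = q n.+1 - \sum_(i < n.+1) a i * p (n.+1 - i)%N.
  by rewrite -E addrAC subrr add0r.
rewrite subr_ge0 -(ler_pM2r (pgt0 n)); apply: le_trans (qp n).
rewrite -apq /conv !mulr_suml; apply: ler_sum => i _.
have ni : (i <= n)%N by rewrite -ltnS.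
rewrite -!mulrA ler_wpM2l ?IHn//.
by rewrite subSn// mulrC [leRHS]mulrC mulrC lc// leq_subr.
Qed.

(** As [p 0 = 1], [a n] is the last term of the convolution sum, whose other terms are
    nonnegative. *)
Lemma deconv_le a p q :
  p 0%N = 1 -> (forall n, 0 <= p n) -> (forall n, 0 <= a n) ->
  (forall n, conv a p n = q n) -> forall n, a n <= q n.
Proof.
move=> p0 pge0 age0 apq n; rewrite -apq /conv big_ord_recr/= subnn p0 mulr1.
by rewrite lerDr sumr_ge0// => i _; rewrite mulr_ge0.
Qed.

End Deconvolution.

(** * Coefficients of the logarithm and of the inverse of F *)

Section LogarithmicSeriesCoefficients.
Variable R : realFieldType.

(* 2F1(1,1;2;x) = \sum_n hcoef n x^n, with logarithm \sum_n hlog n x^n and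
   logarithmic derivative \sum_n hdlog n x^n. *)
Definition hcoef (n : nat) : R := n.+1%:R^-1.

Definition hlog (n : nat) : R := log_coef hcoef n.

Definition hdlog (n : nat) : R := n.+1%:R * hlog n.+1.

(* The coefficients of 1 / \sum_n hcoef n x^n. *)
Definition hinv (n : nat) : R :=
  if n is m.+1 then (if m is k.+1 then hdlog m - hdlog k else hdlog 0 - 1)
  else 1.

Let S0 (n : nat) : n.+1%:R != 0 :> R. Proof. by rewrite pnatr_eq0. Qed.

Lemma hcoef_gt0 n : 0 < hcoef n. Proof. by rewrite invr_gt0. Qed.

Lemma hcoef_ge0 n : 0 <= hcoef n. Proof. by rewrite ltW ?hcoef_gt0. Qed.

Lemma hcoef0 : hcoef 0 = 1. Proof. by rewrite /hcoef invr1. Qed.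

Lemma hcoef_le1 n : hcoef n <= 1.
Proof. by rewrite invf_le1 ?ler1n. Qed.

Let hcoef_anti n : hcoef n.+1 <= hcoef n.
Proof. by rewrite lef_pV2 ?posrE// ler_nat. Qed.

(** Cross multiplied, this is (n+2)(k+1) <= (k+2)(n+1), that is, k <= n. *)
Let hcoef_logconvex k n : (k <= n)%N ->
  hcoef k.+1 * hcoef n <= hcoef n.+1 * hcoef k.
Proof.
move=> kn; rewrite /hcoef -!invfM lef_pV2 ?posrE ?mulr_gt0//.
by rewrite -!natrM ler_nat !(mulSn, mulnS) mulnC; lia.
Qed.

Lemma conv_hdlog n : conv hdlog hcoef n = 1 - hcoef n.+1.
Proof.
rewrite /hdlog /hlog log_coef_rec ?hcoef0// /hcoef.
apply: (mulIf (S0 n.+1)); rewrite divfK// mulrBl mulVf// mul1r.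
by rewrite -[in RHS]addn1 natrD addrK.
Qed.

(** The ratio hypothesis of [deconv_ge0] holds because the coefficients 1 - 1/(n+2) of F' increase
    while those of F decrease. *)
Lemma hdlog_ge0 n : 0 <= hdlog n.
Proof.
apply: (@deconv_ge0 R hdlog hcoef (fun n => 1 - hcoef n.+1)) => //.
- exact: hcoef0.
- exact: hcoef_gt0.
- by rewrite subr_ge0 hcoef_le1.
- move=> m; apply: ler_pM; rewrite ?subr_ge0 ?hcoef_le1 ?hcoef_ge0 ?hcoef_anti//.
  by rewrite lerB// hcoef_anti.
- exact: conv_hdlog.
Qed.

Lemma hdlog_le1 n : hdlog n <= 1.
Proof.
apply: (@le_trans _ _ (1 - hcoef n.+1)).
  apply: (@deconv_le R hdlog hcoef (fun n => 1 - hcoef n.+1)) => [|m|m|m].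
  - exact: hcoef0.
  - exact: hcoef_ge0.
  - exact: hdlog_ge0.
  - exact: conv_hdlog.
by rewrite gerBl hcoef_ge0.
Qed.

Lemma hlog_ge0 n : 0 <= hlog n.+1.
Proof. by have := hdlog_ge0 n; rewrite pmulr_rge0. Qed.

Lemma hlog_le1 n : hlog n.+1 <= 1.
Proof.
by apply: le_trans (hdlog_le1 n); rewrite ler_peMl ?hlog_ge0// ler1n.
Qed.

(** From x F = -log(1 - x) comes F + x F' = 1/(1 - x); with F' = R F this gives 1/F = (1 - x)(1 + x
    R), the origin of the differences in [hinv]. Without the constant term and with the sign
    changed, the identity has the shape that [deconv_ge0] takes. *)
Lemma conv_hinv_shift n : conv (fun k => - hinv k.+1) hcoef n = hcoef n.+1.
Proof.
case: n => [|n].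
  rewrite /conv big_ord1/= opprB mulrBl mul1r subn0 hcoef0.
  by have := conv_hdlog 0; rewrite /conv big_ord1 subn0 hcoef0 mulr1 => ->; ring.
have := conv_hdlog n.+1; rewrite /conv big_ord_recl/= subn0 => E1.
have := conv_hdlog n; rewrite /conv => E0.
rewrite /conv big_ord_recl/= subn0 opprB mulrBl mul1r.
under eq_bigr do rewrite opprB mulrBl.
rewrite sumrB; under eq_bigr do rewrite /bump/= add1n subSS.
rewrite E0; under eq_bigr do rewrite /bump/= add1n subSS.
move: E1; under eq_bigr do rewrite /bump/= add1n subSS.
by move=> /eqP; rewrite addrC -subr_eq => /eqP <-; ring.
Qed.

Lemma conv_hinv n : conv hinv hcoef n = (n == 0)%:R.
Proof.
rewrite /conv big_ord_recl/= mul1r subn0; case: n => [|n].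
  by rewrite big_ord0 hcoef0 addr0.
under eq_bigr do rewrite /bump/= add1n subSS.
by rewrite -conv_hinv_shift /conv -big_split/= big1// => i _; rewrite mulNr addNr.
Qed.

Lemma hinv_le0 n : hinv n.+1 <= 0.
Proof.
rewrite -oppr_ge0; move: n; apply: (@deconv_ge0 R _ hcoef (fun n => hcoef n.+1)).
- exact: hcoef0.
- exact: hcoef_gt0.
- exact: hcoef_logconvex.
- exact: hcoef_ge0.
- by move=> n; rewrite mulrC; have := hcoef_logconvex (leqnSn n); rewrite mulrC.
- exact: conv_hinv_shift.
Qed.

(** The differences telescope. Since [hdlog] is nonnegative, the nonconstant coefficients of 1/F
    have total absolute value at most 1. *)
Lemma sum_hinv n : \sum_(i < n.+1) - hinv i.+1 = 1 - hdlog n.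
Proof.
elim: n => [|n IHn]; first by rewrite big_ord1/= opprB.
by rewrite big_ord_recr/= IHn; ring.
Qed.

End LogarithmicSeriesCoefficients.

(** * Differentiation and Cauchy products of geometrically bounded series *)

Section GeometricallyBoundedSeries.
Variable R : realType.
Implicit Types (a b : R^nat) (r s : R).

Definition geometrically_bounded r a := exists C, forall n, `|a n| <= C * r ^+ n.

Lemma geometrically_boundedW r s a : 0 <= r -> r <= s ->
  geometrically_bounded r a -> geometrically_bounded s a.
Proof.
move=> r0 rs [C aC]; exists C => n; apply: (le_trans (aC n)).
have C0 : 0 <= C by have := le_trans (normr_ge0 _) (aC 0%N); rewrite mulr1.
by rewrite ler_wpM2l// lerXn2r ?nnegrE// (le_trans r0).
Qed.

Lemma geometrically_bounded_cvg r a : 0 <= r -> r < 1 ->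
  geometrically_bounded r a -> cvgn (series a).
Proof.
move=> r0 r1 [C aC]; apply: normed_cvg.
apply: (@series_le_cvg _ _ (geometric C r)) => [n|n|n|] /=; rewrite ?normr_ge0//.
  exact: le_trans (normr_ge0 _) (aC n).
by apply: is_cvg_geometric_series; rewrite ger0_norm.
Qed.

(** With d = s/r - 1, Bernoulli's inequality gives (s/r)^n >= 1 + n d, and (1 + 1/d)(1 + n d) >= n +
    1; hence D = 1 + 1/d. *)
Let succ_mul_expr r s : 0 < r -> r < s ->
  exists D, forall n, n.+1%:R * r ^+ n <= D * s ^+ n.
Proof.
move=> r0 rs; pose d := s / r - 1.
have d0 : 0 < d by rewrite subr_gt0 ltr_pdivlMr// mul1r.
have bernoulli n : 1 + n%:R * d <= (s / r) ^+ n.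
  elim: n => [|n IHn]; first by rewrite mul0r addr0.
  rewrite exprS; apply: (@le_trans _ _ ((1 + d) * (1 + n%:R * d))).
    have ndd : 0 <= n%:R * d * d by rewrite !mulr_ge0// ltW.
    rewrite (_ : (1 + d) * _ = 1 + (n%:R + 1) * d + n%:R * d * d); last by ring.
    by rewrite natr1 lerDl.
  have -> : 1 + d = s / r by rewrite /d addrC subrK.
  by rewrite ler_wpM2l// divr_ge0 ?ltW// (lt_trans r0).
exists (1 + d^-1) => n.
have -> : s ^+ n = (s / r) ^+ n * r ^+ n by rewrite -exprMn divfK// gt_eqF.
rewrite mulrA ler_wpM2r ?exprn_ge0 ?(ltW r0)//.
apply: (@le_trans _ _ ((1 + d^-1) * (1 + n%:R * d))); last first.
  by rewrite ler_wpM2l// addr_ge0// invr_ge0 ltW.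
have -> : (1 + d^-1) * (1 + n%:R * d) = n.+1%:R + (n%:R * d + d^-1).
  by rewrite -nat1r; field; rewrite gt_eqF.
by rewrite lerDl addr_ge0 ?invr_ge0 ?mulr_ge0 ?(ltW d0).
Qed.

Lemma geometrically_bounded_diffs r s a : 0 < r -> r < s ->
  geometrically_bounded r a -> geometrically_bounded s (pseries_diffs a).
Proof.
move=> r0 rs [C aC]; have [D rD] := succ_mul_expr r0 rs.
have C0 : 0 <= C by have := le_trans (normr_ge0 _) (aC 0%N); rewrite mulr1.
exists (C * r * D) => n; rewrite /pseries_diffs normrM ger0_norm//.
apply: (@le_trans _ _ (n.+1%:R * (C * r ^+ n.+1))); first by rewrite ler_wpM2l.
rewrite (_ : _ * (_ * _) = C * r * (n.+1%:R * r ^+ n)); last first.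
  by rewrite exprS; ring.
by rewrite -[leRHS]mulrA ler_wpM2l// mulr_ge0// ltW.
Qed.

Lemma geometrically_bounded_pseries r a x : 0 <= r -> `|x| * r < 1 ->
  geometrically_bounded r a -> cvgn (pseries a x).
Proof.
move=> r0 xr [C aC]; apply: (@geometrically_bounded_cvg (`|x| * r)) => //.
  by rewrite mulr_ge0.
exists C => n; rewrite /= normrM exprMn mulrCA [leLHS]mulrC normrX.
by rewrite ler_wpM2l ?exprn_ge0.
Qed.

Lemma is_derive_pseries r a x : 0 < r -> r < 1 -> `|x| <= 1 ->
  geometrically_bounded r a ->
  is_derive x (1 : R) (fun t => limn (pseries a t))
    (limn (pseries (pseries_diffs a) x)).
Proof.
move=> r0 r1 x1 ar.
(* Termwise differentiation requires convergence of the series and of its first two derived series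
   at a point beyond [x]. Each derivation costs a larger rate: s and t cut [r, 1] in thirds, u is
   the midpoint of t and 1, and the point is 1/u > 1. *)
have [/andP[rs s1] [t2 tu]] : (r < (1 + 2 * r) / 3 < 1) /\
  ((1 + 2 * r) / 3 < (2 + r) / 3 /\ (2 + r) / 3 < (5 + r) / 6) by lra.
have u1 : (5 + r) / 6 < 1 by lra.
set s := (1 + 2 * r) / 3 in rs s1 t2; set t := (2 + r) / 3 in t2 tu.
set u := (5 + r) / 6 in tu u1.
have s0 := lt_trans r0 rs; have t0 := lt_trans s0 t2; have u0 := lt_trans t0 tu.
have gs := geometrically_bounded_diffs r0 rs ar.
have gt := geometrically_bounded_diffs s0 t2 gs.
have Ku v : v < u -> `|u^-1| * v < 1.
  by move=> vu; rewrite ger0_norm ?invr_ge0 ?ltW// mulrC ltr_pdivrMr// mul1r.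
apply: (@pseries_snd_diffs _ _ u^-1).
- by apply: (geometrically_bounded_pseries (ltW r0)) ar; apply: Ku; lra.
- by apply: (geometrically_bounded_pseries (ltW s0)) gs; apply: Ku; lra.
- by apply: (geometrically_bounded_pseries (ltW t0)) gt; apply: Ku.
- by rewrite (le_lt_trans x1)// ger0_norm ?invr_ge0 ?ltW// invf_gt1.
Qed.

Let series_conv a b n :
  series (conv a b) n = \sum_(i < n) a i * series b (n - i)%N.
Proof.
elim: n => [|n IHn]; first by rewrite /series/= big_geq// big_ord0.
rewrite seriesSr IHn big_ord_recr/= subSnn.
transitivity (\sum_(i < n.+1) (a i * series b (n - i)%N + a i * b (n - i)%N)).
  rewrite big_split/= -/(conv a b n) [in RHS]big_ord_recr/= subnn.
  by rewrite [series b 0]/series/= big_geq// mulr0 addr0.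
rewrite big_ord_recr/= subnn; congr (_ + _); last first.
  by rewrite -mulrDr seriesSr.
by apply: eq_bigr => i _; rewrite -mulrDr -seriesSr subSn// ltnW.
Qed.

Let sum_expr_le r m n : 0 < r -> r < 1 -> (m <= n)%N ->
  \sum_(m <= i < n) r ^+ i <= r ^+ m / (1 - r).
Proof.
move=> r0 r1 mn; rewrite ler_pdivlMr ?subr_gt0// mulr_suml.
under eq_bigr do rewrite mulrBr mulr1 -exprSr -opprB.
by rewrite sumrN telescope_sumr// opprB gerBl exprn_ge0// ltW.
Qed.

(** Compared with the product of partial sums, the partial sum of the convolution lacks, for each i
    < n, a_i times the terms of b from n - i to n - 1. Each such defect is at most K r^n, and a rate
    s > r absorbs the factor n. *)
Lemma geometrically_bounded_conv r a b : 0 < r -> r < 1 ->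
  geometrically_bounded r a -> geometrically_bounded r b ->
  series (conv a b) @ \oo --> limn (series a) * limn (series b).
Proof.
move=> r0 r1 ar br.
have ca := geometrically_bounded_cvg (ltW r0) r1 ar.
have cb := geometrically_bounded_cvg (ltW r0) r1 br.
have [C aC] := ar; have [D bD] := br.
have C0 : 0 <= C by have := le_trans (normr_ge0 _) (aC 0%N); rewrite mulr1.
have D0 : 0 <= D by have := le_trans (normr_ge0 _) (bD 0%N); rewrite mulr1.
have [/andP[rs s1] s0] : (r < (1 + r) / 2 < 1) /\ 0 < (1 + r) / 2 by lra.
set s := (1 + r) / 2 in rs s1 s0; have [B rB] := succ_mul_expr r0 rs.
pose K := C * (D / (1 - r)).
have K0 : 0 <= K by rewrite !mulr_ge0// invr_ge0 subr_ge0 ltW.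
have diffE n : `|series (conv a b) n - series a n * series b n| <= K * B * s ^+ n.
  apply: (@le_trans _ _ (K * (n.+1%:R * r ^+ n))); last first.
    by rewrite -mulrA ler_wpM2l.
  rewrite series_conv [series a]seriesEord/= mulr_suml -sumrB.
  apply: (le_trans (ler_norm_sum _ _ _)).
  apply: (@le_trans _ _ (\sum_(i < n) K * r ^+ n)); last first.
    rewrite sumr_const card_ord -[leLHS]mulr_natl [leLHS]mulrCA ler_wpM2l// ler_wpM2r//.
      by rewrite exprn_ge0// ltW.
    by rewrite ler_nat.
  apply: ler_sum => i _; have ni : (i <= n)%N by rewrite ltnW.
  rewrite -mulrBr normrM distrC.
  have -> : K * r ^+ n = C * r ^+ i * (D * (r ^+ (n - i) / (1 - r))).
    by rewrite -[in LHS](subnK ni) exprD /K; ring.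
  apply: ler_pM => //; rewrite sub_series_geq ?leq_subr//.
  apply: (le_trans (ler_norm_sum _ _ _)).
  apply: (le_trans (ler_sum _ (fun j _ => bD j))).
  by rewrite -mulr_sumr ler_wpM2l// sum_expr_le// leq_subr.
apply: cvg_sub0 (cvgM ca cb).
apply/norm_cvg0P; apply: (@squeeze_cvgr _ _ _ _ (cst 0) (geometric (K * B) s)).
- by near=> n; rewrite normr_ge0/=; exact: diffE.
- exact: cvg_cst.
- by apply: cvg_geometric; rewrite ger0_norm// ltW.
Unshelve. all: by end_near. Qed.

End GeometricallyBoundedSeries.

(** * Moduli, real and imaginary parts of complex powers *)

Section ComplexPowers.
Variable R : rcfType.
Implicit Types (w z : R[i]).

Lemma complex_normE z : `|z| = (normc z)%:C.
Proof. by case: z => x y; rewrite normc_def. Qed.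

Lemma normc_ge0 z : 0 <= normc z.
Proof. by case: z => x y; exact: sqrtr_ge0. Qed.

Lemma normcX z n : normc (z ^+ n) = normc z ^+ n.
Proof.
elim: n => [|n IHn]; first exact: ComplexField.Normc.normc1.
by rewrite !exprS ComplexField.Normc.normcM IHn.
Qed.

Lemma normc_real (x : R) : normc x%:C = `|x|.
Proof. by rewrite /= expr0n addr0 sqrtr_sqr. Qed.

Lemma norm_Re_le z : `|complex.Re z| <= normc z.
Proof.
case: z => x y /=; rewrite -sqrtr_sqr ler_sqrt ?lerDl ?sqr_ge0//.
by rewrite addr_ge0 ?sqr_ge0.
Qed.

Lemma norm_Im_le z : `|complex.Im z| <= normc z.
Proof.
case: z => x y /=; rewrite -sqrtr_sqr ler_sqrt ?lerDr ?sqr_ge0//.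
by rewrite addr_ge0 ?sqr_ge0.
Qed.

Lemma Re_addc w z : complex.Re (w + z) = complex.Re w + complex.Re z.
Proof. by case: w; case: z. Qed.

Lemma Im_addc w z : complex.Im (w + z) = complex.Im w + complex.Im z.
Proof. by case: w; case: z. Qed.

Lemma Re_mulc w z : complex.Re (w * z) =
  complex.Re w * complex.Re z - complex.Im w * complex.Im z.
Proof. by case: w; case: z. Qed.

Lemma Im_mulc w z : complex.Im (w * z) =
  complex.Re w * complex.Im z + complex.Im w * complex.Re z.
Proof. by case: w; case: z. Qed.

Lemma Re_realc_mul (t : R) z : complex.Re (t%:C * z) = t * complex.Re z.
Proof. by rewrite Re_mulc/= mul0r subr0. Qed.

Lemma Im_realc_mul (t : R) z : complex.Im (t%:C * z) = t * complex.Im z.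
Proof. by rewrite Im_mulc/= mul0r addr0. Qed.

Lemma Re_exp_ray (t : R) z n : complex.Re ((t%:C * z) ^+ n) = complex.Re (z ^+ n) * t ^+ n.
Proof. by rewrite exprMn -rmorphXn Re_realc_mul mulrC. Qed.

Lemma Im_exp_ray (t : R) z n : complex.Im ((t%:C * z) ^+ n) = complex.Im (z ^+ n) * t ^+ n.
Proof. by rewrite exprMn -rmorphXn Im_realc_mul mulrC. Qed.

End ComplexPowers.

(** * Complex power series with real coefficients *)

Section ComplexPowerSeries.
Variable R : realType.
Implicit Types (a b : R^nat) (w z : R[i]).

Lemma cvg_complex (u v : R^nat) (x y : R) :
  u @ \oo --> x -> v @ \oo --> y ->
  (fun n => u n +i* v n : (R[i] : numFieldType)) @ \oo --> (x +i* y : (R[i] : numFieldType)).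
Proof.
(* In the order of [R[i]], [0 < e] forces the imaginary part of [e] to vanish, so the tolerance is a
   positive real. *)
move=> ux vy; apply/cvgrPdist_lt => -[e1 e2]; rewrite ltcE/= => /andP[/eqP-> e0].
have e20 : 0 < e1 / 2 by rewrite divr_gt0.
have /cvgrPdist_lt/(_ _ e20) nu := ux; have /cvgrPdist_lt/(_ _ e20) nv := vy.
near=> n.
have -> : (x +i* y) - (u n +i* v n) = (x - u n)%:C + 'i%C * (y - v n)%:C.
  by apply/eqP; rewrite eq_complex/= !(mul0r, mul1r, subr0, addr0, add0r) !eqxx.
apply: (le_lt_trans (ler_normD _ _)).
rewrite !complex_normE ComplexField.Normc.normcM !normc_real -rmorphD ltcR.
rewrite [normc 'i%C]/= expr0n expr1n add0r sqrtr1 mul1r (splitr e1) ltrD//.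
- by near: n.
- by near: n.
Unshelve. all: by end_near. Qed.

(** A pair of real limits, so that along a ray both components are real power series in the
    parameter. *)
Definition csum a z : R[i] :=
  limn (series (fun n => a n * complex.Re (z ^+ n))) +i*
  limn (series (fun n => a n * complex.Im (z ^+ n))).

Let geometrically_bounded_Re a z : geometrically_bounded 1 a ->
  geometrically_bounded (normc z) (fun n => a n * complex.Re (z ^+ n)).
Proof.
move=> [C aC]; exists C => n; rewrite normrM; apply: ler_pM => //.
  by have := aC n; rewrite expr1n mulr1.
by rewrite -normcX norm_Re_le.
Qed.

Let geometrically_bounded_Im a z : geometrically_bounded 1 a ->
  geometrically_bounded (normc z) (fun n => a n * complex.Im (z ^+ n)).
Proof.
move=> [C aC]; exists C => n; rewrite normrM; apply: ler_pM => //.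
  by have := aC n; rewrite expr1n mulr1.
by rewrite -normcX norm_Im_le.
Qed.

Lemma cvg_Re_csum a z : geometrically_bounded 1 a -> normc z < 1 ->
  series (fun n => a n * complex.Re (z ^+ n)) @ \oo --> complex.Re (csum a z).
Proof.
move=> a1 z1; have := geometrically_bounded_Re z a1.
exact: geometrically_bounded_cvg (normc_ge0 z) z1.
Qed.

Lemma cvg_Im_csum a z : geometrically_bounded 1 a -> normc z < 1 ->
  series (fun n => a n * complex.Im (z ^+ n)) @ \oo --> complex.Im (csum a z).
Proof.
move=> a1 z1; have := geometrically_bounded_Im z a1.
exact: geometrically_bounded_cvg (normc_ge0 z) z1.
Qed.

Lemma cvg_csum a z : geometrically_bounded 1 a -> normc z < 1 ->
  series (fun n => (a n)%:C * z ^+ n : (R[i] : numFieldType)) @ \oo -->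
    (csum a z : (R[i] : numFieldType)).
Proof.
move=> a1 z1.
rewrite (_ : series _ = fun n =>
  series (fun n => a n * complex.Re (z ^+ n)) n +i*
  series (fun n => a n * complex.Im (z ^+ n)) n).
  by apply: cvg_complex; [exact: cvg_Re_csum|exact: cvg_Im_csum].
apply/funext => n; elim: n => [|n IHn]; first by rewrite /series/= !big_geq.
by rewrite !seriesSr IHn; apply/eqP; rewrite eq_complex Re_addc Im_addc Re_realc_mul Im_realc_mul/= !eqxx.
Qed.

Lemma csum_conv a b z :
  geometrically_bounded 1 a -> geometrically_bounded 1 b -> normc z < 1 ->
  csum (conv a b) z = csum a z * csum b z.
Proof.
move=> a1 b1 z1; have z0 := normc_ge0 z.
(* The Cauchy product needs a positive rate, and [z] may be 0; the midpoint of |z| and 1 serves. *)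
have [/andP[zr r1] r0] : (normc z <= (1 + normc z) / 2 < 1) /\ 0 < (1 + normc z) / 2.
  by lra.
set r := (1 + normc z) / 2 in zr r1 r0.
have W := geometrically_boundedW z0 zr.
have ra := W _ (geometrically_bounded_Re z a1).
have ia := W _ (geometrically_bounded_Im z a1).
have rb := W _ (geometrically_bounded_Re z b1).
have ib := W _ (geometrically_bounded_Im z b1).
apply/eqP; rewrite eq_complex Re_mulc Im_mulc/=; apply/andP; split; apply/eqP.
  apply/cvg_lim => //.
  rewrite (_ : (fun n => _) =
    (conv (fun n => a n * complex.Re (z ^+ n)) (fun n => b n * complex.Re (z ^+ n)))
    - (conv (fun n => a n * complex.Im (z ^+ n)) (fun n => b n * complex.Im (z ^+ n)))).
    by rewrite seriesD seriesN; apply: cvgB; exact: (geometrically_bounded_conv r0 r1).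
  apply/funext => n; rewrite /conv fctE -sumrB mulr_suml; apply: eq_bigr => k _.
  have kn : (k <= n)%N by rewrite -ltnS.
  rewrite (_ : z ^+ n = z ^+ k * z ^+ (n - k)); last by rewrite -exprD subnKC.
  by rewrite Re_mulc; ring.
apply/cvg_lim => //.
rewrite (_ : (fun n => _) =
    (conv (fun n => a n * complex.Re (z ^+ n)) (fun n => b n * complex.Im (z ^+ n)))
    + (conv (fun n => a n * complex.Im (z ^+ n)) (fun n => b n * complex.Re (z ^+ n)))).
  by rewrite seriesD; apply: cvgD; exact: (geometrically_bounded_conv r0 r1).
apply/funext => n; rewrite /conv fctE -big_split mulr_suml; apply: eq_bigr => k _.
have kn : (k <= n)%N by rewrite -ltnS.
rewrite (_ : z ^+ n = z ^+ k * z ^+ (n - k)); last by rewrite -exprD subnKC.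
by rewrite Im_mulc/=; ring.
Qed.

Let ray_radius z : normc z < 1 ->
  {r | [/\ normc z <= r, r < 1 & 0 < r]}.
Proof. by move=> z1; have z0 := normc_ge0 z; exists ((1 + normc z) / 2); split; lra. Qed.

Let normc_ray z (t : R) : normc z < 1 -> `|t| <= 1 -> normc (t%:C * z) < 1.
Proof.
move=> z1 t1; rewrite ComplexField.Normc.normcM normc_real.
by apply: le_lt_trans z1; rewrite ler_piMl ?normc_ge0.
Qed.

(** The chain rule d/dt f(t z) = z f'(t z). The real series in [t] has coefficients a_n Re(z^n), of
    rate |z| < 1, so the endpoint t = 1 is included. *)
Lemma is_derive_csum_Re a z (t : R) : geometrically_bounded 1 a ->
  geometrically_bounded 1 (pseries_diffs a) -> normc z < 1 -> `|t| <= 1 ->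
  is_derive t (1 : R) (fun t => complex.Re (csum a (t%:C * z)))
    (complex.Re (z * csum (pseries_diffs a) (t%:C * z))).
Proof.
move=> a1 d1 z1 t1; have [r [zr r1 r0]] := ray_radius z1.
have ra := geometrically_boundedW (normc_ge0 z) zr (geometrically_bounded_Re z a1).
have := is_derive_pseries r0 r1 t1 ra.
rewrite (_ : (fun _ => _) = (fun t => complex.Re (csum a (t%:C * z)))); last first.
  apply/funext => u; congr (limn (series _)); apply/funext => n /=.
  by rewrite Re_exp_ray mulrA.
suff -> : limn (pseries (pseries_diffs (fun n => a n * complex.Re (z ^+ n))) t) =
  complex.Re (z * csum (pseries_diffs a) (t%:C * z)) by [].
have tz := normc_ray z1 t1.
apply/cvg_lim => //; rewrite Re_mulc.
rewrite (_ : pseries _ t = complex.Re z *: series (fun n => pseries_diffs a n * complex.Re ((t%:C * z) ^+ n))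
  - complex.Im z *: series (fun n => pseries_diffs a n * complex.Im ((t%:C * z) ^+ n))).
  by apply: cvgB; apply: cvgZr; [exact: cvg_Re_csum|exact: cvg_Im_csum].
rewrite -!seriesZ -seriesN -seriesD; congr series; apply/funext => n.
by rewrite !fctE /= /pseries_diffs Re_exp_ray Im_exp_ray exprS Re_mulc /GRing.scale/=; ring.
Qed.

Lemma is_derive_csum_Im a z (t : R) : geometrically_bounded 1 a ->
  geometrically_bounded 1 (pseries_diffs a) -> normc z < 1 -> `|t| <= 1 ->
  is_derive t (1 : R) (fun t => complex.Im (csum a (t%:C * z)))
    (complex.Im (z * csum (pseries_diffs a) (t%:C * z))).
Proof.
move=> a1 d1 z1 t1; have [r [zr r1 r0]] := ray_radius z1.
have ra := geometrically_boundedW (normc_ge0 z) zr (geometrically_bounded_Im z a1).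
have := is_derive_pseries r0 r1 t1 ra.
rewrite (_ : (fun _ => _) = (fun t => complex.Im (csum a (t%:C * z)))); last first.
  apply/funext => u; congr (limn (series _)); apply/funext => n /=.
  by rewrite Im_exp_ray mulrA.
suff -> : limn (pseries (pseries_diffs (fun n => a n * complex.Im (z ^+ n))) t) =
  complex.Im (z * csum (pseries_diffs a) (t%:C * z)) by [].
have tz := normc_ray z1 t1.
apply/cvg_lim => //; rewrite Im_mulc.
rewrite (_ : pseries _ t = complex.Re z *: series (fun n => pseries_diffs a n * complex.Im ((t%:C * z) ^+ n))
  + complex.Im z *: series (fun n => pseries_diffs a n * complex.Re ((t%:C * z) ^+ n))).
  by apply: cvgD; apply: cvgZr; [exact: cvg_Im_csum|exact: cvg_Re_csum].
rewrite -!seriesZ -seriesD; congr series; apply/funext => n.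
by rewrite !fctE /= /pseries_diffs Re_exp_ray Im_exp_ray exprS Im_mulc /GRing.scale/=; ring.
Qed.

End ComplexPowerSeries.

(** * A linear differential equation and the principal logarithm *)

Section PolarForm.
Variable R : realType.

Lemma derive0_constant_on01 (f : R -> R) :
  (forall t : R, t \in `[0, 1] -> is_derive t (1 : R) f 0) -> f 1 = f 0.
Proof.
move=> f0.
have cf : {within `[(0 : R), 1], continuous f}.
  apply: derivable_within_continuous => t t01.
  by have [] := f0 t t01.
have df (t : R) : t \in `]0, 1[%R -> is_derive t (1 : R) f (cst 0 t).
  by move=> t01; apply: f0; exact: subset_itv_oo_cc.
have [t _] := MVT_segment (@ler01 R) df cf.
by rewrite mul0r => /eqP; rewrite subr_eq0 => /eqP.
Qed.

(** The hypotheses say that U + iV solves F' = (M + iN)' F, so exp(-(M + iN)) (U + iV) is constant.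
    Its real and imaginary parts are the two quantities differentiated below; undoing the rotation
    by N(1) and the factor exp(-M(1)) gives the claim. *)
Lemma polar_ode (M N U V dM dN : R -> R) :
  (forall t : R, t \in `[0, 1] -> is_derive t (1 : R) M (dM t)) ->
  (forall t : R, t \in `[0, 1] -> is_derive t (1 : R) N (dN t)) ->
  (forall t : R, t \in `[0, 1] ->
     is_derive t (1 : R) U (dM t * U t - dN t * V t)) ->
  (forall t : R, t \in `[0, 1] ->
     is_derive t (1 : R) V (dM t * V t + dN t * U t)) ->
  M 0 = 0 -> N 0 = 0 -> U 0 = 1 -> V 0 = 0 ->
  U 1 = expR (M 1) * cos (N 1) /\ V 1 = expR (M 1) * sin (N 1).
Proof.
move=> dMP dNP dUP dVP M0 N0 U0 V0.
have /derive0_constant_on01 : forall t : R, t \in `[0, 1] -> is_derive t (1 : R)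
    ((expR \o - M) * (U * (cos \o N) + V * (sin \o N))) 0.
  move=> t t01; have ? := dMP t t01; have ? := dNP t t01.
  have ? := dUP t t01; have ? := dVP t t01.
  by apply: is_derive_eq; rewrite /GRing.scale/= !fctE/=; ring.
have /derive0_constant_on01 : forall t : R, t \in `[0, 1] -> is_derive t (1 : R)
    ((expR \o - M) * (V * (cos \o N) - U * (sin \o N))) 0.
  move=> t t01; have ? := dMP t t01; have ? := dNP t t01.
  have ? := dUP t t01; have ? := dVP t t01.
  by apply: is_derive_eq; rewrite /GRing.scale/= !fctE/=; ring.
rewrite !fctE/= M0 N0 U0 V0 oppr0 expR0 cos0 sin0 !(mul1r, mul0r, mulr0, subr0, addr0).
move=> g f; have cs := cos2Dsin2 (N 1); have e := expRxMexpNx_1 (M 1).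
move: e f g cs; set E := expR _; set E' := expR _; set c := cos _; set s := sin _.
move=> e f g cs; split.
  transitivity (E * E' * (U 1 * (c ^+ 2 + s ^+ 2))); first by rewrite e cs mul1r mulr1.
  transitivity (E * (c * (E' * (U 1 * c + V 1 * s)) - s * (E' * (V 1 * c - U 1 * s)))).
    by ring.
  by rewrite f g; ring.
transitivity (E * E' * (V 1 * (c ^+ 2 + s ^+ 2))); first by rewrite e cs mul1r mulr1.
transitivity (E * (s * (E' * (U 1 * c + V 1 * s)) + c * (E' * (V 1 * c - U 1 * s)))).
  by ring.
by rewrite f g; ring.
Qed.

Lemma Clog_polar (x y : R) : - (pi / 2) < y -> y < pi / 2 ->
  Clog ((expR x * cos y) +i* (expR x * sin y)) = x +i* y.
Proof.
move=> y1 y2; have pi0 := pi_gt0 R.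
have nE : normc ((expR x * cos y) +i* (expR x * sin y)) = expR x.
  rewrite /= !exprMn -mulrDr cos2Dsin2 mulr1 sqrtr_sqr.
  by rewrite ger0_norm ?expR_ge0.
rewrite /Clog nE expRK; congr (_ +i* _); rewrite /Carg nE /=.
rewrite mulrAC divff ?gt_eqF ?expR_gt0// mul1r pmulr_rge0 ?expR_gt0//.
(* [acos] recovers only |y|; the sign of the imaginary part, here that of sin y, restores the
   sign. *)
have [y0|y0] := leP 0 y.
  rewrite sin_ge0_pi; last by rewrite y0/=; lra.
  by rewrite cosK// in_itv/= y0/=; lra.
rewrite ifF; first by rewrite cosKN ?opprK// (ltW y0) andbT; lra.
by apply/negbTE; rewrite -ltNge -oppr_gt0 -sinN sin_gt0_pi// oppr_gt0 y0/=; lra.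
Qed.

End PolarForm.

(** * From a formal logarithm to the principal logarithm *)

Section LogarithmOfPowerSeries.
Variables (R : realType) (p q : R^nat).
Hypothesis p1 : geometrically_bounded 1 p.
Hypothesis dp1 : geometrically_bounded 1 (pseries_diffs p).
Hypothesis q1 : geometrically_bounded 1 q.
Hypothesis dq1 : geometrically_bounded 1 (pseries_diffs q).
Hypothesis p0 : p 0%N = 1.
Hypothesis q0 : q 0%N = 0.
Hypothesis dpE : forall n, conv (pseries_diffs q) p n = pseries_diffs p n.

Lemma csum0 (a : R^nat) : csum a 0 = (a 0%N)%:C.
Proof.
have H (u : R^nat) : (forall n, u n.+1 = 0) -> limn (series u) = u 0%N.
  move=> u0; apply/cvg_lim => //; rewrite -(cvg_shiftn 1)/=.
  rewrite (_ : (fun n => _) = cst (u 0%N)); first exact: cvg_cst.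
  apply/funext => n; rewrite addn1 /series/= big_nat_recl// big1 ?addr0//.
rewrite /csum !H ?expr0 ?mulr1 ?mulr0//= => n; by rewrite expr0n/= mulr0.
Qed.

Lemma csum_polar z : normc z < 1 ->
  csum p z = (expR (complex.Re (csum q z)) * cos (complex.Im (csum q z))) +i*
             (expR (complex.Re (csum q z)) * sin (complex.Im (csum q z))).
Proof.
move=> z1; pose d (t : R) := z * csum (pseries_diffs q) (t%:C * z).
have t1P (t : R) : t \in `[0, 1] -> `|t| <= 1.
  by rewrite in_itv/= => /andP[t0 t1]; rewrite ger0_norm.
have dE (t : R) : t \in `[0, 1] ->
    z * csum (pseries_diffs p) (t%:C * z) = d t * csum p (t%:C * z).
  move=> /t1P t1; rewrite /d -mulrA -csum_conv//.
    by rewrite (_ : conv _ _ = pseries_diffs p)//; apply/funext.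
  rewrite ComplexField.Normc.normcM normc_real.
  by apply: le_lt_trans z1; rewrite ler_piMl ?normc_ge0.
have := @polar_ode _ (fun t => complex.Re (csum q (t%:C * z)))
  (fun t => complex.Im (csum q (t%:C * z))) (fun t => complex.Re (csum p (t%:C * z)))
  (fun t => complex.Im (csum p (t%:C * z)))
  (fun t => complex.Re (d t)) (fun t => complex.Im (d t)).
rewrite !mul0r !mul1r !csum0 p0 q0/=.
case=> // [t /t1P t1|t /t1P t1|t t01|t t01|E1 E2].
- exact: is_derive_csum_Re.
- exact: is_derive_csum_Im.
- rewrite [X in is_derive _ _ _ X](_ : _ = complex.Re (d t * csum p (t%:C * z))).
    by rewrite -dE//; apply: is_derive_csum_Re => //; exact: t1P.
  by rewrite Re_mulc.
- rewrite [X in is_derive _ _ _ X](_ : _ = complex.Im (d t * csum p (t%:C * z))).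
    by rewrite -dE//; apply: is_derive_csum_Im => //; exact: t1P.
  by rewrite Im_mulc addrC [X in X + _]mulrC [X in _ + X]mulrC; ring.
by apply/eqP; rewrite eq_complex/= E1 E2 !eqxx.
Qed.

(** Positivity of exp(M) cos N, the real part along the ray, keeps cos N away from 0. As N is
    continuous with N(0) = 0, it cannot reach pi/2 or -pi/2, so the polar form at t = 1 is that of
    the principal branch. *)
Lemma Clog_csum z : normc z < 1 ->
  (forall t : R, t \in `[0, 1] -> 0 < complex.Re (csum p (t%:C * z))) ->
  Clog (csum p z) = csum q z.
Proof.
move=> z1 pos; pose N (t : R) := complex.Im (csum q (t%:C * z)).
have tz (t : R) : t \in `[0, 1] -> normc (t%:C * z) < 1.
  rewrite in_itv/= => /andP[t0 t1].
  rewrite ComplexField.Normc.normcM normc_real ger0_norm//.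
  by apply: le_lt_trans z1; rewrite ler_piMl ?normc_ge0.
have cosN0 (t : R) : t \in `[0, 1] -> cos (N t) != 0.
  move=> t01; have := pos t t01; rewrite csum_polar ?tz//=.
  by rewrite pmulr_rgt0 ?expR_gt0// => /gt_eqF ->.
have N0 : N 0 = 0 by rewrite /N mul0r csum0 q0.
have N1 : N 1 = complex.Im (csum q z) by rewrite /N mul1r.
have Nc : {within `[0, 1], continuous N}.
  apply: derivable_within_continuous => t; rewrite in_itv/= => /andP[t0 t1].
  have : is_derive t (1 : R) N (complex.Im (z * csum (pseries_diffs q) (t%:C * z))).
    by apply: is_derive_csum_Im => //; rewrite ger0_norm.
  by case.
have pi0 := pi_gt0 R.
have N_lt : complex.Im (csum q z) < pi / 2.
  rewrite -N1 ltNge; apply/negP => N1ge.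
  have mM : Num.min (N 0) (N 1) <= pi / 2 <= Num.max (N 0) (N 1).
    by rewrite N0 ge_min le_max N1ge orbT andbT divr_ge0 ?pi_ge0.
  have [t t01 Nt] := IVT (@ler01 R) Nc mM.
  by have := cosN0 t t01; rewrite Nt cos_pihalf eqxx.
have N_gt : - (pi / 2) < complex.Im (csum q z).
  rewrite -N1 ltNge; apply/negP => N1le.
  have mM : Num.min (N 0) (N 1) <= - (pi / 2) <= Num.max (N 0) (N 1).
    by rewrite N0 ge_min le_max N1le orbT/= oppr_le0 divr_ge0 ?pi_ge0.
  have [t t01 Nt] := IVT (@ler01 R) Nc mM.
  by have := cosN0 t t01; rewrite Nt cosN cos_pihalf eqxx.
by rewrite csum_polar// Clog_polar//; case: csum.
Qed.

End LogarithmOfPowerSeries.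

(** * Positivity of Re F and the logarithm of F *)

Section LogarithmicSeries.
Variable R : realType.
Implicit Types (a : R^nat) (x alpha : R) (z : R[i]).
Let p : R^nat := @hcoef R.
Let q : R^nat := @hlog R.

Let bounded1 a : (forall n, `|a n| <= 1) -> geometrically_bounded 1 a.
Proof. by move=> a1; exists 1 => n; rewrite expr1n mulr1. Qed.

Lemma hcoef_bounded : geometrically_bounded 1 p.
Proof. by apply: bounded1 => n; rewrite ger0_norm ?hcoef_ge0 ?hcoef_le1. Qed.

Lemma conv_dhlog n : conv (pseries_diffs q) p n = pseries_diffs p n.
Proof. by rewrite -[RHS](@log_coef_rec _ p)// /p hcoef0. Qed.

Lemma dhcoef_bounded : geometrically_bounded 1 (pseries_diffs p).
Proof.
apply: bounded1 => n; rewrite -conv_dhlog (conv_hdlog R n).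
have := hcoef_ge0 R n.+1; have := hcoef_le1 R n.+1.
by move=> ? ?; rewrite ler_norml; lra.
Qed.

Lemma hlog0 : q 0 = 0.
Proof. by rewrite /q /hlog /log_coef big_geq// mulr0. Qed.

Lemma hlog_bounded : geometrically_bounded 1 q.
Proof.
apply: bounded1 => -[|n]; first by rewrite hlog0 normr0.
by rewrite ger0_norm ?hlog_ge0 ?hlog_le1.
Qed.

Lemma dhlog_bounded : geometrically_bounded 1 (pseries_diffs q).
Proof. by apply: bounded1 => n; rewrite ger0_norm ?hdlog_ge0 ?hdlog_le1. Qed.

Let hinv1 : geometrically_bounded 1 (@hinv R).
Proof.
have d0 := hdlog_ge0 R; have d1 := hdlog_le1 R.
apply: bounded1 => -[|[|n]]; rewrite ?normr1// ler_norml/=.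
  by have := d0 0; have := d1 0; lra.
by have := d0 n; have := d1 n; have := d0 n.+1; have := d1 n.+1; lra.
Qed.

(** Writing 1/F = 1 - sum b_n z^n, one has Re(1/F) >= 1 - |z| sum b_n >= 1 - |z|. *)
Let Re_hinv_gt0 z : normc z < 1 -> 0 < complex.Re (csum (@hinv R) z).
Proof.
move=> z1; apply: (@lt_le_trans _ _ (1 - normc z)); first by rewrite subr_gt0.
have := cvg_Re_csum hinv1 z1; rewrite -cvg_shiftS => /cvgr_to_ge; apply.
apply: nearW => n; rewrite /series/= big_nat_recl//= mul1r.
rewrite lerD2l big_mkord -[leRHS]opprK lerN2 -sumrN.
(* The partial sum has only [n] nonconstant terms; one more nonnegative term is added to match
   [sum_hinv]. *)
apply: (@le_trans _ _ (\sum_(i < n.+1) - hinv R i.+1 * normc z)).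
  rewrite big_ord_recr/= -[leLHS]addr0; apply: lerD; last first.
    by rewrite mulr_ge0 ?normc_ge0// oppr_ge0 hinv_le0.
  apply: ler_sum => i _; rewrite -mulNr ler_wpM2l// ?oppr_ge0 ?hinv_le0//.
  apply: (le_trans (ler_norm _)); apply: (le_trans (norm_Re_le _)).
  by rewrite normcX exprS ler_piMr ?normc_ge0// exprn_ile1 ?normc_ge0// ltW.
rewrite -mulr_suml sum_hinv ler_piMl ?normc_ge0// gerBl.
exact: hdlog_ge0.
Qed.

Let Re_csum_gt0 z : normc z < 1 -> 0 < complex.Re (csum p z).
Proof.
move=> z1; have : csum (@hinv R) z * csum p z = 1.
  rewrite -csum_conv//; last exact: hcoef_bounded.
  rewrite (_ : conv _ _ = fun n => (n == 0)%N%:R).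
    apply/eqP; rewrite eq_complex/=; apply/andP; split; apply/eqP.
      apply/cvg_lim => //; rewrite -(cvg_shiftn 1)/=.
      rewrite (_ : (fun n => _) = cst 1); first exact: cvg_cst.
      apply/funext => n; rewrite addn1 /series/= big_nat_recl// big1 ?addr0 ?mulr1// => i _.
      by rewrite mul0r.
    apply/cvg_lim => //.
    rewrite (_ : series _ = cst 0); first exact: cvg_cst.
    apply/funext => n; rewrite /series/= big1// => -[|i] _; first by rewrite mulr0.
    by rewrite mul0r.
  by apply/funext => n; exact: conv_hinv.
have := Re_hinv_gt0 z1; move: (csum _ z) (csum p z) => [x y] [u v] /= x0 /eqP.
rewrite eq_complex/= => /andP[/eqP E1 /eqP E2].
(* For w = x + iy with w F = 1, Re F = Re w / |w|^2. *)
have : 0 < u * (x ^+ 2 + y ^+ 2).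
  rewrite (_ : _ * _ = x * (x * u - y * v) + y * (x * v + y * u)); last by ring.
  by rewrite E1 E2 mulr0 addr0 mulr1.
have s0 : 0 < x ^+ 2 + y ^+ 2 by rewrite ltr_wpDr ?sqr_ge0 ?exprn_gt0.
by rewrite pmulr_lgt0.
Qed.

Lemma Clog_hcoef z : normc z < 1 -> Clog (csum p z) = csum q z.
Proof.
move=> z1; apply: Clog_csum => //.
- exact: hcoef_bounded.
- exact: dhcoef_bounded.
- exact: hlog_bounded.
- exact: dhlog_bounded.
- exact: hcoef0.
- exact: hlog0.
- exact: conv_dhlog.
move=> t; rewrite in_itv/= => /andP[t0 t1]; apply: Re_csum_gt0.
rewrite ComplexField.Normc.normcM normc_real ger0_norm//.
by apply: le_lt_trans z1; rewrite ler_piMl ?normc_ge0.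
Qed.

Lemma csum_hcoef_polar z : normc z < 1 ->
  csum p z = (expR (complex.Re (csum q z)) * cos (complex.Im (csum q z))) +i*
             (expR (complex.Re (csum q z)) * sin (complex.Im (csum q z))).
Proof.
apply: csum_polar.
- exact: hcoef_bounded.
- exact: dhcoef_bounded.
- exact: hlog_bounded.
- exact: dhlog_bounded.
- exact: hcoef0.
- exact: hlog0.
- exact: conv_dhlog.
Qed.

End LogarithmicSeries.

(** * Index shifts and hypergeometric coefficients *)

Section SeriesShift.
Variable K : numFieldType.
Implicit Types (u : K^nat) (z : K).

Lemma cvg_series_shift u l :
  series (fun n => u n.+1) @ \oo --> l <-> series u @ \oo --> l + u 0%N.
Proof.
have E : (fun n => series u n.+1) = series (fun n => u n.+1) \+ cst (u 0%N).
  by apply/funext => n; rewrite /series/= big_nat_recl//= addrC.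
split=> [ul|ul].
  by rewrite -cvg_shiftS [X in X @ _]E; apply: cvgD => //; exact: cvg_cst.
move: ul; rewrite -cvg_shiftS [X in X @ _ --> _]E => ul.
rewrite (_ : series _ = (series (fun n => u n.+1) \+ cst (u 0%N)) \- cst (u 0%N)).
  by rewrite -[l](addrK (u 0%N)); apply: cvgB => //; exact: cvg_cst.
by apply/funext => n /=; rewrite addrK.
Qed.

Lemma cvg_series_shift0 u (l : K) : u 0%N = 0 ->
  series u @ \oo --> l -> series (fun n => u n.+1) @ \oo --> l.
Proof. by move=> u0 ul; apply/cvg_series_shift; rewrite u0 addr0. Qed.

Lemma pochhammer1 n : pochhammer 1 n = n`!%:R :> K.
Proof.
elim: n => [|n IHn]; first by rewrite /pochhammer big_ord0.
by rewrite /pochhammer big_ord_recr/= -/(pochhammer 1 n) IHn nat1r -natrM factS mulnC.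
Qed.

Lemma pochhammer2 n : pochhammer 2 n = n.+1`!%:R :> K.
Proof.
elim: n => [|n IHn]; first by rewrite /pochhammer big_ord0.
rewrite /pochhammer big_ord_recr/= -/(pochhammer 2 n) IHn -natrD -natrM.
by rewrite add2n [in RHS]factS mulnC.
Qed.

Lemma hypergeometric2F1_112 z l :
  series (fun n => z ^+ n / n.+1%:R) @ \oo --> l -> hypergeometric2F1 1 1 2 z = l.
Proof.
move=> zl; apply/cvg_lim => //.
suff -> : (fun n => pochhammer 1 n * pochhammer 1 n / pochhammer 2 n *
  (z ^+ n / n`!%:R)) = (fun n => z ^+ n / n.+1%:R) by [].
apply/funext => n; rewrite pochhammer1 pochhammer2 factS natrM.
by field; rewrite nat1r !pnatr_eq0 -!lt0n fact_gt0.
Qed.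

Lemma one_plus_G (alpha s : K) l :
  series (fun n => (alpha * s) ^+ n / n.+1%:R) @ \oo --> l -> 1 + G alpha s = l.
Proof.
rewrite -[l](subrK 1) => zl; rewrite addrC; congr (_ + 1); apply/cvg_lim => //.
by apply/(cvg_series_shift (fun n => (alpha * s) ^+ n / n.+1%:R)); rewrite expr0 divr1.
Qed.

End SeriesShift.

(** * The sums of the series for F and log F, complex and real *)

Section LogarithmicSeriesSum.
Variable R : realType.
Implicit Types (x y alpha : R) (z s : R[i]).

Let cvg_csum_hcoef z : normc z < 1 ->
  series (fun n => z ^+ n / n.+1%:R : (R[i] : numFieldType)) @ \oo -->
    (csum (@hcoef R) z : (R[i] : numFieldType)).
Proof.
move=> z1; rewrite (_ : (fun n => _) = fun n => (@hcoef R n)%:C * z ^+ n).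
  exact: cvg_csum (hcoef_bounded R) z1.
by apply/funext => n; rewrite mulrC /hcoef fmorphV rmorph_nat.
Qed.

Lemma one_plus_G_csum alpha s : normc (alpha%:C * s) < 1 ->
  1 + G alpha%:C s = csum (@hcoef R) (alpha%:C * s).
Proof. by move=> z1; apply: one_plus_G; exact: cvg_csum_hcoef. Qed.

Lemma hypergeometric2F1_G alpha s : normc (alpha%:C * s) < 1 ->
  hypergeometric2F1 1 1 2 (alpha%:C * s) = 1 + G alpha%:C s.
Proof.
move=> z1; rewrite one_plus_G_csum//; apply: hypergeometric2F1_112.
exact: cvg_csum_hcoef.
Qed.

Lemma cvg_hlog_complex alpha s : normc (alpha%:C * s) < 1 ->
  series (fun n => s ^+ n.+1 * (alpha ^+ n.+1 * hlog R n.+1)%:C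
    : (R[i] : numFieldType)) @ \oo --> (Clog (1 + G alpha%:C s) : (R[i] : numFieldType)).
Proof.
move=> z1; rewrite one_plus_G_csum// Clog_hcoef//.
rewrite (_ : (fun n => s ^+ n.+1 * _) =
  fun n => (hlog R n.+1)%:C * (alpha%:C * s) ^+ n.+1).
  apply: (@cvg_series_shift0 _ (fun n => (hlog R n)%:C * (alpha%:C * s) ^+ n)).
    by rewrite hlog0 mul0r.
  exact: cvg_csum (hlog_bounded R) z1.
by apply/funext => n; rewrite exprMn rmorphM rmorphXn; ring.
Qed.

Let Re_real_exp y n : complex.Re (y%:C ^+ n) = y ^+ n.
Proof. by rewrite -rmorphXn. Qed.

Let Im_real_exp y n : complex.Im (y%:C ^+ n) = 0.
Proof. by rewrite -rmorphXn. Qed.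

Let real_normc_lt1 y : 0 <= y -> y < 1 -> normc y%:C < 1.
Proof. by move=> y0 y1; rewrite normc_real ger0_norm. Qed.

Lemma cvg_hcoef y : 0 <= y -> y < 1 -> cvgn (series (fun n => y ^+ n / n.+1%:R)).
Proof.
move=> y0 y1; apply/cvg_ex; exists (complex.Re (csum (@hcoef R) y%:C)).
rewrite (_ : (fun n => _) = fun n => @hcoef R n * complex.Re (y%:C ^+ n)).
  exact: cvg_Re_csum (hcoef_bounded R) (real_normc_lt1 y0 y1).
by apply/funext => n; rewrite Re_real_exp mulrC.
Qed.

(** On the real axis the imaginary part of the logarithm is 0, so the polar form reads F = exp(log
    F) and [ln] inverts it directly. *)
Lemma cvg_hlog alpha x : 0 <= alpha * x -> alpha * x < 1 ->
  series (fun n => hlog R n.+1 * (alpha * x) ^+ n.+1) @ \oo --> ln (1 + G alpha x).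
Proof.
set y := alpha * x => y0 y1; have z1 := real_normc_lt1 y0 y1.
have hE : csum (@hcoef R) y%:C = (1 + G alpha x)%:C.
  apply/eqP; rewrite eq_complex; apply/andP; split; apply/eqP.
    symmetry; apply: one_plus_G.
    rewrite (_ : (fun n => _) = fun n => @hcoef R n * complex.Re (y%:C ^+ n)).
      exact: cvg_Re_csum (hcoef_bounded R) z1.
    by apply/funext => n; rewrite Re_real_exp mulrC.
  apply/cvg_lim => //; rewrite (_ : series _ = cst 0); first exact: cvg_cst.
  by apply/funext => n; rewrite /series/= big1// => i _; rewrite Im_real_exp mulr0.
have lE : complex.Im (csum (@hlog R) y%:C) = 0.
  apply/cvg_lim => //; rewrite (_ : series _ = cst 0); first exact: cvg_cst.
  by apply/funext => n; rewrite /series/= big1// => i _; rewrite Im_real_exp mulr0.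
have := csum_hcoef_polar z1; rewrite hE lE cos0 sin0 !mulr1 mulr0 => -[->].
rewrite expRK (_ : (fun n => hlog R n.+1 * _) =
  fun n => hlog R n.+1 * complex.Re (y%:C ^+ n.+1)).
  apply: (@cvg_series_shift0 _ (fun n => hlog R n * complex.Re (y%:C ^+ n))).
    by rewrite hlog0 mul0r.
  exact: cvg_Re_csum (hlog_bounded R) z1.
by apply/funext => n; rewrite Re_real_exp.
Qed.

End LogarithmicSeriesSum.

(** * Existence and uniqueness of the Levy measure *)

Section LevyMassOfLogarithmicSeries.
Variable R : realType.
Implicit Types (a : R^nat) (x alpha : R).

(** The sum of the (alpha t)^n / n over n >= 1, plus ln(1 - alpha t), has derivative 0 on [0, 1] and
    vanishes at 0; t = 1 gives alpha F(alpha) = -ln(1 - alpha). *)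
Lemma one_plus_G_at1 alpha : 0 < alpha -> alpha < 1 ->
  1 + G alpha 1 = - ln (1 - alpha) / alpha.
Proof.
(* c 0 = 1 / 0 = 0 *)
move=> a0 a1; pose c (n : nat) : R := alpha ^+ n / n%:R.
have gc : geometrically_bounded alpha c.
  exists 1 => n; rewrite mul1r /c normrM ger0_norm ?exprn_ge0 ?(ltW a0)//.
  rewrite ler_piMr ?exprn_ge0 ?(ltW a0)// ger0_norm ?invr_ge0//.
  by case: n => [|n]; rewrite ?invr0 ?invf_le1 ?ler1n.
have diffE (t : R) : t \in `[0, 1] -> limn (pseries (pseries_diffs c) t) = alpha / (1 - alpha * t).
  rewrite in_itv/= => /andP[t0 t1].
  rewrite (_ : pseries _ t = series (geometric alpha (alpha * t))).
    apply/cvg_lim => //; apply: cvg_geometric_series.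
    rewrite ger0_norm ?mulr_ge0 ?(ltW a0)//.
    by apply: le_lt_trans a1; rewrite ler_piMr ?(ltW a0).
  congr series; apply/funext => n /=; rewrite /pseries_diffs /c exprMn exprS.
  by field; rewrite nat1r pnatr_eq0.
have : limn (pseries c 1) + ln (1 - alpha * 1) = limn (pseries c 0) + ln (1 - alpha * 0).
  apply: (@derive0_constant_on01 _
    ((fun t => limn (pseries c t)) + (@ln R \o (cst 1 - alpha *: id)))) => t t01.
  have t1 : `|t| <= 1 by move: t01; rewrite in_itv/= => /andP[t0 t1]; rewrite ger0_norm.
  have ? := is_derive_pseries a0 a1 t1 gc.
  have p0 : 0 < 1 - alpha * t.
    rewrite subr_gt0; apply: le_lt_trans a1; rewrite ler_piMr ?(ltW a0)//.
    exact: le_trans (ler_norm _) t1.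
  have ? := @is_derive1_ln R (1 - alpha * t) p0.
  apply: is_derive_eq; rewrite diffE// /GRing.scale/= mulr1 sub0r.
  by rewrite mulrN mulrC subrr.
have -> : limn (pseries c 0) = 0.
  apply/cvg_lim => //; rewrite (_ : pseries _ _ = cst 0); first exact: cvg_cst.
  apply/funext => n; rewrite /pseries/series/= big1// => -[|i] _.
    by rewrite /c invr0 mulr0 mul0r.
  by rewrite expr0n mulr0.
rewrite mulr0 subr0 ln1 addr0 mulr1 => /eqP; rewrite addr_eq0 => /eqP E.
apply: one_plus_G; rewrite -E.
have c1 : cvgn (pseries c 1).
  by apply: (geometrically_bounded_pseries (ltW a0)) gc; rewrite normr1 mul1r.
rewrite [X in _ --> X]mulrC (_ : series _ = alpha^-1 *: series (fun n => c n.+1 * 1 ^+ n.+1)).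
  apply: cvgZr; apply: (@cvg_series_shift0 _ (fun n => c n * 1 ^+ n)) => //.
  by rewrite /c invr0 mulr0 mul0r.
rewrite -seriesZ; congr series; apply/funext => n; rewrite !fctE.
rewrite /c /GRing.scale/= expr1n !mulr1 exprS; field.
by rewrite nat1r pnatr_eq0 (gt_eqF a0).
Qed.

(** For x <= 1/2 the terms of positive degree add up to at most C x / (1 - x) <= 2 C x, so [a 0]
    vanishes as x tends to 0; dividing by x then leaves the shifted series. Only positive x occur,
    since x will be exp(-lambda). *)
Let pseries_eq0_head a C : (forall n, `|a n| <= C) ->
  (forall x, 0 < x -> x < 1 -> series (fun n => a n * x ^+ n) @ \oo --> (0 : R)) ->
  a 0%N = 0 /\
  forall x, 0 < x -> x < 1 -> series (fun n => a n.+1 * x ^+ n) @ \oo --> (0 : R).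
Proof.
move=> aC a0; have C0 : 0 <= C := le_trans (normr_ge0 _) (aC 0%N).
have tail x : 0 < x -> x < 1 ->
    series (fun n => a n.+1 * x ^+ n.+1) @ \oo --> - a 0%N.
  move=> x0 x1; apply/(cvg_series_shift (fun n => a n * x ^+ n)).
  by rewrite expr0 mulr1 addNr; exact: a0.
have small x : 0 < x -> x <= 1 / 2 -> `|a 0%N| <= 2 * C * x.
  move=> x0 x2; have x1 : x < 1 by lra.
  rewrite -normrN; have /cvg_norm/cvgr_to_le := tail x x0 x1; apply.
  apply: nearW => n; apply: (le_trans (ler_norm_sum _ _ _)).
  apply: (@le_trans _ _ (series (geometric (C * x) x) n)).
    apply: ler_sum => i _; rewrite normrM (ger0_norm (exprn_ge0 _ (ltW x0))).
    by rewrite exprS /= mulrA ler_wpM2r ?exprn_ge0 ?(ltW x0)// ler_wpM2r ?(ltW x0).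
  apply: le_trans (geometric_le_lim _ _ _ _) _ => //.
  - by rewrite mulr_ge0 ?(ltW x0).
  - by rewrite ger0_norm ?(ltW x0).
  rewrite (_ : 2 * C * x = C * x * 2); last by ring.
  rewrite ler_wpM2l ?mulr_ge0 ?(ltW x0)//.
  by rewrite -[leRHS]invrK lef_pV2 ?posrE ?invr_gt0//; lra.
have a00 : a 0%N = 0.
  apply/eqP; apply/negPn/negP => an0; have ap : 0 < `|a 0%N| by rewrite normr_gt0.
  move: ap small; set b := `|_| => ap small.
  (* At x = b / (4 (b + C)), which is at most 1/4, the bound 2 C x is below b/2, contradicting b <=
     2 C x. Including b in the denominator covers C = 0. *)
  have K0 : 0 < 4 * (b + C) by rewrite mulr_gt0// ltr_pwDl.
  have bb : 0 < b * b by rewrite mulr_gt0.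
  have bC : 0 <= b * C by rewrite mulr_ge0// ltW.
  have h : b / (4 * (b + C)) <= 1 / 2 by rewrite ler_pdivrMr//; lra.
  have := small _ (divr_gt0 ap K0) h.
  by rewrite (mulrA (2 * C) b) ler_pdivlMr//; lra.
split=> // x x0 x1; rewrite (_ : series _ = x^-1 *: series (fun n => a n.+1 * x ^+ n.+1)).
  rewrite -[0 in X in _ --> X](mulr0 x^-1) -[0 in X in _ --> X]oppr0 -[in X in - X]a00.
  by apply: (cvgM (cvg_cst _)); exact: tail.
rewrite -seriesZ; congr series; apply/funext => n; rewrite !fctE /GRing.scale/= exprS.
by field; rewrite gt_eqF.
Qed.

Lemma pseries_eq0 a : geometrically_bounded 1 a ->
  (forall x, 0 < x -> x < 1 -> series (fun n => a n * x ^+ n) @ \oo --> (0 : R)) ->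
  forall n, a n = 0.
Proof.
move=> [C aC] a0 n; have {}aC k : `|a k| <= C by have := aC k; rewrite expr1n mulr1.
elim: n a aC a0 => [|n IHn] a aC a0; have [h0 h1] := pseries_eq0_head aC a0 => //.
exact: (IHn (fun n => a n.+1)).
Qed.

Lemma eseries_EFin_cvg (f : R^nat) (l : R) :
  series (fun n => f n.+1) @ \oo --> l -> (\sum_(1 <= n <oo) (f n)%:E)%E = l%:E.
Proof.
move=> fl; apply/cvg_lim => //.
rewrite -cvg_shiftS (_ : (fun n => _) = EFin \o series (fun n => f n.+1)).
  by apply: cvg_comp fl _; exact: cvg_refl.
by apply/funext => n; rewrite /= sumEFin big_add1.
Qed.

(** Nonnegativity makes the extended partial sums converge, so that the value of the limit carries
    information. *)
Lemma cvg_eseries_EFin (f : R^nat) (l : R) : (forall n, 0 <= f n.+1) ->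
  (\sum_(1 <= n <oo) (f n)%:E)%E = l%:E -> series (fun n => f n.+1) @ \oo --> l.
Proof.
move=> f0 fl.
have : (fun n => (\sum_(1 <= i < n) (f i)%:E)%E) @ \oo --> l%:E.
  by rewrite -fl; apply: is_cvg_nneseries => -[|n]//; rewrite lee_fin.
rewrite -cvg_shiftS (_ : [sequence _]_n = EFin \o series (fun n => f n.+1)).
  by move=> /fine_cvgP[].
by apply/funext => n; rewrite /= sumEFin big_add1.
Qed.

Variables (alpha : R) (psi : R -> R).
Hypotheses (alpha_gt0 : 0 < alpha) (alpha_lt1 : alpha < 1).
Hypothesis psiE : forall lambda, 0 <= lambda ->
  psi lambda = ln (1 + G alpha 1) - ln (1 + G alpha (expR (- lambda))).

Lemma cvg_hlog01 x : 0 <= x -> x <= 1 ->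
  series (fun n => alpha ^+ n.+1 * hlog R n.+1 * x ^+ n.+1) @ \oo --> ln (1 + G alpha x).
Proof.
move=> x0 x1; rewrite (_ : (fun n => _) = fun n => hlog R n.+1 * (alpha * x) ^+ n.+1).
  apply: cvg_hlog; first by rewrite mulr_ge0// ltW.
  by apply: le_lt_trans alpha_lt1; rewrite ler_piMr// ltW.
by apply/funext => n; rewrite exprMn; ring.
Qed.

Let expRNM (lambda : R) n : expR (- (lambda * n%:R)) = expR (- lambda) ^+ n.
Proof. by rewrite -mulNr expRM_natr. Qed.

Let cvg_levy_terms lambda (w : R^nat) (m l : R) :
  series (fun n => w n.+1 * 1 ^+ n.+1) @ \oo --> m ->
  series (fun n => w n.+1 * expR (- lambda) ^+ n.+1) @ \oo --> l ->
  series (fun n => (1 - expR (- (lambda * n.+1%:R))) * w n.+1) @ \oo --> m - l.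
Proof.
move=> wm wl; rewrite (_ : series _ = series (fun n => w n.+1 * 1 ^+ n.+1)
    - series (fun n => w n.+1 * expR (- lambda) ^+ n.+1)); first exact: cvgB.
rewrite -seriesN -seriesD; congr series; apply/funext => n.
by rewrite !fctE expRNM expr1n; ring.
Qed.

Lemma levy_measure_hlog : levy_measure psi (fun n => alpha ^+ n * hlog R n).
Proof.
split=> [[|n]// _|lambda lambda0].
  by rewrite mulr_ge0 ?hlog_ge0// exprn_ge0// ltW.
symmetry; apply: eseries_EFin_cvg.
rewrite psiE//; apply: (cvg_levy_terms (w := fun n => alpha ^+ n * hlog R n)).
  exact: cvg_hlog01.
by apply: cvg_hlog01; rewrite ?expR_ge0// -expR0 ler_expR oppr_le0.
Qed.

Lemma levy_measure_unique (Pi : R^nat) : levy_measure psi Pi ->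
  forall n, Pi n.+1 = alpha ^+ n.+1 * hlog R n.+1.
Proof.
move=> [Pi0 PiE].
have e01 lambda : 0 <= lambda -> expR (- lambda) <= 1.
  by move=> l0; rewrite -expR0 ler_expR oppr_le0.
have Pi_cvg lambda : 0 <= lambda ->
    series (fun n => (1 - expR (- (lambda * n.+1%:R))) * Pi n.+1) @ \oo --> psi lambda.
  move=> l0; apply: (cvg_eseries_EFin (f := fun n => (1 - expR (- (lambda * n%:R))) * Pi n)).
    by move=> n; rewrite mulr_ge0 ?Pi0// subr_ge0 e01// mulr_ge0.
  by rewrite -PiE.
have e1 : expR (- 1) < 1 :> R by rewrite -expR0 ltr_expR oppr_lt0.
(* For n >= 1, 1 - exp(-n) >= 1 - exp(-1), so the convergent series for psi(1) dominates the
   masses. *)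
have Pi_sum : cvgn (series (fun n => Pi n.+1)).
  apply: (@series_le_cvg _ _ (fun n => (1 - expR (-1))^-1 *
    ((1 - expR (- (1 * n.+1%:R))) * Pi n.+1))) => [n|n|n|].
  - exact: Pi0.
  - by rewrite mulr_ge0 ?invr_ge0 ?subr_ge0 ?(ltW e1)// mulr_ge0 ?Pi0// subr_ge0 e01// mulr_ge0.
  - rewrite mulrA ler_peMl ?Pi0// mulrC ler_pdivlMr ?subr_gt0// [1 * (1 - _)]mul1r lerB//.
    by rewrite ler_expR lerN2 mul1r ler1n.
  - by apply: is_cvg_seriesZ; apply/cvg_ex; exists (psi 1); exact: Pi_cvg.
pose theta := limn (series (fun n => Pi n.+1)).
have thetaP : series (fun n => Pi n.+1 * 1 ^+ n.+1) @ \oo --> theta.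
  rewrite (_ : (fun n => _) = fun n => Pi n.+1)//.
  by apply/funext => n; rewrite expr1n mulr1.
(* The constant term compares the two total masses. With it, equality of the exponents at lambda =
   -ln x says that the power series of [a] vanishes at x. *)
pose a n := if n is m.+1 then Pi m.+1 - alpha ^+ m.+1 * hlog R m.+1
            else ln (1 + G alpha 1) - theta.
suff a0 : forall n, a n = 0 by move=> n; apply/eqP; rewrite -subr_eq0; apply/eqP; exact: (a0 n.+1).
apply: pseries_eq0.
  have [K [_ PiK]] := cvg_series_bounded Pi_sum.
  exists (`|a 0%N| + `|K + 1| + 1) => n; rewrite expr1n mulr1.
  case: n => [|n]; first by rewrite -addrA lerDl addr_ge0.
  apply: (le_trans (ler_normB _ _)); rewrite -addrA ler_wpDl// lerD//.
    by apply: le_trans (ler_norm _); apply: (PiK (K + 1)) => //; rewrite ltrDl.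
  have h0 := hlog_ge0 R n; have h1 := hlog_le1 R n.
  have alpha_n : 0 <= alpha ^+ n.+1 by rewrite exprn_ge0// ltW.
  rewrite ger0_norm; last exact: mulr_ge0.
  apply: mulr_ile1 => //.
  by rewrite exprn_ile1 ?(ltW alpha_gt0)// ltW.
move=> x x0 x1; pose lambda := - ln x.
have xE : expR (- lambda) = x by rewrite opprK lnK.
have l0 : 0 <= lambda by rewrite oppr_ge0 ln_le0// ltW.
rewrite -[X in _ --> X](subrK (a 0%N * x ^+ 0)).
apply/(cvg_series_shift (fun n => a n * x ^+ n)).
have Pix : series (fun n => Pi n.+1 * x ^+ n.+1) @ \oo --> theta - psi lambda.
  rewrite (_ : series _ = series (fun n => Pi n.+1 * 1 ^+ n.+1) -
     series (fun n => (1 - expR (- (lambda * n.+1%:R))) * Pi n.+1)).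
    by apply: cvgB => //; exact: Pi_cvg.
  rewrite -seriesN -seriesD; congr series; apply/funext => n.
  by rewrite !fctE expRNM expr1n xE; ring.
have E : (fun n => Pi n.+1 * x ^+ n.+1 : R) -
    (fun n => alpha ^+ n.+1 * hlog R n.+1 * x ^+ n.+1) = fun n => a n.+1 * x ^+ n.+1.
  by apply/funext => n; rewrite !fctE /a; ring.
rewrite [X in _ --> X](_ : _ = theta - psi lambda - ln (1 + G alpha x)).
  by rewrite -E seriesD seriesN; apply: cvgB => //; apply: cvg_hlog01; exact: ltW.
by rewrite psiE// xE/= expr0; ring.
Qed.

End LevyMassOfLogarithmicSeries.

(** * Cauchy's functional equation on the half-line *)

Section MultiplicativeFunctions.
Variable R : realType.

(** Subtracting t f(1) leaves an additive g that vanishes at the integers. A lower bound for g near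
    0 spreads to the whole half-line, and additivity then forces g = 0. *)
Lemma additive_linear (f : R -> R) (delta C : R) :
  (forall s t, 0 <= s -> 0 <= t -> f (s + t) = f s + f t) ->
  0 < delta -> (forall t, 0 <= t -> t <= delta -> C <= f t) ->
  forall t, 0 <= t -> f t = t * f 1.
Proof.
move=> fD d0 fC; pose g t := f t - t * f 1.
have gD s t : 0 <= s -> 0 <= t -> g (s + t) = g s + g t.
  by move=> s0 t0; rewrite /g fD//; ring.
have g0 : g 0 = 0.
  by apply: (addrI (g 0)); rewrite -gD// !addr0.
have gM n t : 0 <= t -> g (n%:R * t) = n%:R * g t.
  move=> t0; elim: n => [|n IHn]; first by rewrite !mul0r g0.
  by rewrite -natr1 mulrDl mul1r gD ?mulr_ge0// IHn; ring.
have g1 : g 1 = 0 by rewrite /g mul1r subrr.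
have gn n : g n%:R = 0 by have := gM n 1 ler01; rewrite mulr1 g1 mulr0.
(* A step u = 1/N within [delta]: N g(u) = g(1) = 0, so translation by u preserves g. *)
pose N := Num.bound delta^-1; pose u : R := N%:R^-1.
have dN : delta^-1 < N%:R by apply: archi_boundP; rewrite invr_ge0 ltW.
have N0 : 0 < N%:R :> R by apply: lt_trans dN; rewrite invr_gt0.
have u0 : 0 < u by rewrite invr_gt0.
have ud : u <= delta by rewrite -[leRHS]invrK lef_pV2 ?posrE ?invr_gt0// ltW.
have gu : g u = 0.
  have := gM N u (ltW u0); rewrite /u divff ?gt_eqF// g1 => /esym/eqP.
  by rewrite mulf_eq0 gt_eqF//= => /eqP.
pose C' := C - `|delta * f 1|.
have gC0 t : 0 <= t -> t <= delta -> C' <= g t.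
  move=> t0 td; rewrite lerB ?fC//; apply: le_trans (ler_norm _) _.
  by rewrite !normrM ler_wpM2r// !ger0_norm// ltW.
have gC t : 0 <= t -> C' <= g t.
  move=> t0; have : t <= (Num.bound (t * N%:R))%:R * u.
    by rewrite ler_pdivlMr// ltW// archi_boundP// mulr_ge0// ltW.
  move: (Num.bound (t * N%:R)) => n; elim: n t t0 => [|n IHn] t t0 tn.
    by apply: gC0 => //; apply: le_trans tn _; rewrite mul0r ltW.
  have [tu|ut] := leP t u; first by apply: gC0 => //; exact: le_trans ud.
  have tu0 : 0 <= t - u by rewrite subr_ge0 ltW.
  rewrite -(subrK u t) gD ?(ltW u0)// gu addr0; apply: IHn => //.
  by rewrite lerBlDr (le_trans tn)// -natr1 mulrDl mul1r.
(* If g(t) < 0, then g(n t) = n g(t) falls below C' for large n. *)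
have gge0 t : 0 <= t -> 0 <= g t.
  move=> t0; rewrite leNgt; apply/negP => gt0.
  have := archi_boundP (normr_ge0 (C' / g t)); set n := Num.bound _ => nP.
  have : C' <= n%:R * g t by rewrite -gM// gC// mulr_ge0.
  rewrite -ler_ndivlMr// leNgt => /negP; apply.
  exact: le_lt_trans (ler_norm _) nP.
(* For an integer n > t, g(t) = -g(n - t) <= 0. *)
move=> t t0; apply/eqP; rewrite -subr_eq0 -/(g t) eq_le gge0// andbT.
have tn := archi_boundP t0; set n := Num.bound _ in tn.
have nt0 : 0 <= n%:R - t by rewrite subr_ge0 ltW.
have := gn n; rewrite -(subrK t n%:R) gD// => /eqP; rewrite addrC addr_eq0 => /eqP->.
by rewrite oppr_le0 gge0.
Qed.

Local Open Scope ereal_scope.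

(** Splitting t into steps of length at most [delta] gives positivity; once finiteness is known, the
    logarithm of phi is additive and bounded below near 0. *)
Lemma multiplicative_expR (phi : R -> \bar R) (delta c l : R) :
  (forall s t, (0 <= s)%R -> (0 <= t)%R -> phi (s + t)%R = phi s * phi t) ->
  phi 0%R = 1 -> phi 1%R = (expR (- l))%:E -> (0 < delta)%R -> (0 < c)%R ->
  (forall t, (0 <= t)%R -> (t <= delta)%R -> c%:E <= phi t) ->
  forall t : R, (0 <= t)%R -> phi t = (expR (- (t * l)))%:E.
Proof.
move=> phiD phi0 phi1 d0 c0 phic.
have phi_gt0 t : (0 <= t)%R -> 0 < phi t.
  move=> t0; have : (t <= (Num.bound (t / delta))%:R * delta)%R.
    by rewrite -ler_pdivrMr// ltW// archi_boundP// divr_ge0// ltW.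
  move: (Num.bound (t / delta)) => n; elim: n t t0 => [|n IHn] t t0 tn.
    rewrite (@lt_le_trans _ _ c%:E) ?lte_fin// phic//.
    by rewrite (le_trans tn)// mul0r ltW.
  have [td|dt] := leP t delta; first by rewrite (@lt_le_trans _ _ c%:E) ?lte_fin// phic.
  have td0 : (0 <= t - delta)%R by rewrite subr_ge0 ltW.
  rewrite -(subrK delta t) phiD ?(ltW d0)// mule_gt0//; last first.
    by rewrite (@lt_le_trans _ _ c%:E) ?lte_fin// phic// ltW.
  by apply: IHn => //; rewrite lerBlDr (le_trans tn)// -natr1 mulrDl mul1r.
have phin n : phi n%:R%R = (expR (- (n%:R * l)))%:E.
  elim: n => [|n IHn]; first by rewrite mul0r oppr0 expR0.
  rewrite -natr1 phiD// IHn phi1 -EFinM -expRD; congr (expR _)%:E; ring.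
(* If phi(t) were infinite, so would be phi(n) = phi(n - t) phi(t) for an integer n > t,
   contradicting [phin]. *)
have phi_fin t : (0 <= t)%R -> phi t \is a fin_num.
  move=> t0; have tn := archi_boundP t0; set n := Num.bound _ in tn.
  have nt0 : (0 <= n%:R - t)%R by rewrite subr_ge0 ltW.
  have := phin n; rewrite -[X in phi X](subrK t n%:R) phiD//.
  move: (phi_gt0 _ t0) (phi_gt0 _ nt0); case: (phi t) => // _ /gt0_muley ->.
  by [].
have fin_gt0 t : (0 <= t)%R -> (0 < fine (phi t))%R.
  by move=> t0; rewrite fine_gt0// phi_gt0//= ltey_eq phi_fin.
have lnE := @additive_linear (fun t => ln (fine (phi t))) delta (ln c) _ d0 _.
move=> t t0; rewrite -(fineK (phi_fin t t0)) -[fine _]lnK ?posrE ?fin_gt0//.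
congr (expR _)%:E; rewrite lnE// ?phi1/= ?expRK ?mulrN// => [s u s0 u0|u u0 ud].
  by rewrite phiD// fineM ?phi_fin// lnM ?posrE ?fin_gt0.
rewrite ler_ln ?posrE ?fin_gt0// -lee_fin fineK ?phi_fin//.
exact: phic.
Qed.

End MultiplicativeFunctions.

(** * Integrals of functions of random variables *)

Section IndependentIntegrals.
Context d (T : measurableType d) (R : realType) (P : probability T R).
Implicit Types (X Y : T -> R) (f g : R -> \bar R).
Local Open Scope ereal_scope.

Lemma ge0_integral_eq_law X Y f :
  measurable_fun [set: T] X -> measurable_fun [set: T] Y ->
  (forall B, measurable B -> P (X @^-1` B) = P (Y @^-1` B)) ->
  measurable_fun [set: R] f -> (forall x, 0 <= f x) ->
  \int[P]_w f (X w) = \int[P]_w f (Y w).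
Proof.
move=> mX mY XY mf f0.
pose X' : {RV P >-> R} := mfun_Sub (mem_set mX).
pose Y' : {RV P >-> R} := mfun_Sub (mem_set mY).
have <- : \int[distribution P X']_x f x = \int[P]_w f (X w).
  by rewrite ge0_integral_distribution.
have <- : \int[distribution P Y']_x f x = \int[P]_w f (Y w).
  by rewrite ge0_integral_distribution.
by apply: eq_measure_integral => B mB _; exact: XY.
Qed.

(** The joint law agrees with the product law on rectangles, hence everywhere; Tonelli's theorem
    then separates the factors. *)
Lemma ge0_integral_indep X Y f g :
  measurable_fun [set: T] X -> measurable_fun [set: T] Y ->
  (forall A B, measurable A -> measurable B ->
    P (X @^-1` A `&` Y @^-1` B) = P (X @^-1` A) * P (Y @^-1` B)) ->
  measurable_fun [set: R] f -> (forall x, 0 <= f x) ->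
  measurable_fun [set: R] g -> (forall x, 0 <= g x) ->
  \int[P]_w (f (X w) * g (Y w)) = \int[P]_w f (X w) * \int[P]_w g (Y w).
Proof.
move=> mX mY XY mf f0 mg g0.
pose X' : {RV P >-> R} := mfun_Sub (mem_set mX).
pose Y' : {RV P >-> R} := mfun_Sub (mem_set mY).
pose Z' : {RV P >-> (R * R)%type} :=
  mfun_Sub (mem_set (measurable_fun_pair mX mY)).
have mfg : measurable_fun [set: R * R] (fun z => f z.1 * g z.2).
  apply: emeasurable_funM.
    exact: measurableT_comp mf measurable_fst.
  exact: measurableT_comp mg measurable_snd.
have fg0 z : 0 <= f z.1 * g z.2 by rewrite mule_ge0.
have <- : \int[distribution P Z']_z (f z.1 * g z.2) = \int[P]_w (f (X w) * g (Y w)).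
  by rewrite ge0_integral_distribution.
have <- : \int[distribution P X']_x f x = \int[P]_w f (X w).
  by rewrite ge0_integral_distribution.
have <- : \int[distribution P Y']_x g x = \int[P]_w g (Y w).
  by rewrite ge0_integral_distribution.
transitivity (\int[distribution P X' \x distribution P Y']_z (f z.1 * g z.2)).
  apply: eq_measure_integral => A mA _; symmetry.
  by apply: product_measure_unique => // B C mB mC; exact: XY.
rewrite fubini_tonelli1//=.
under eq_integral do rewrite /fubini_F/= ge0_integralZl//.
by rewrite ge0_integralZr// integral_ge0.
Qed.

(** Only point masses are given; since they sum to 1, the event that [X] is not a natural number is
    null. *)
Lemma integral_nat_valued X (p : R^nat) (h : R -> R) (l : R) :
  measurable_fun [set: T] X ->
  (forall k, P (X @^-1` [set k%:R]%R) = (p k)%:E) ->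
  series p @ \oo --> (1 : R)%R ->
  measurable_fun [set: R] h -> (forall x, 0 <= h x)%R ->
  series (fun k => h k%:R * p k)%R @ \oo --> l ->
  \int[P]_w (h (X w))%:E = l%:E.
Proof.
move=> mX Xp p1 mh h0 hl; pose F k := X @^-1` [set k%:R]%R.
have mF k : measurable (F k) by rewrite -[F k]setTI; exact: mX.
have tF : trivIset setT F.
  apply/trivIsetP => i j _ _ ij; rewrite -subset0 /F => w [/= Xi Xj].
  move: Xj; rewrite Xi => /eqP.
  by rewrite eqr_nat (negPf ij).
have mhX : measurable_fun [set: T] (fun w => (h (X w))%:E).
  by apply/measurable_EFinP; exact: measurableT_comp mh mX.
have hX0 w : 0 <= (h (X w))%:E by rewrite lee_fin.
pose D := \bigcup_k F k; have mD : measurable D by exact: bigcup_measurable.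
have eE (u : R^nat) m : series u @ \oo --> m -> \sum_(k <oo) (u k)%:E = m%:E.
  move=> um; apply/cvg_lim => //; rewrite (_ : (fun n => _) = EFin \o series u).
    by apply: cvg_comp um _; exact: cvg_refl.
  by apply/funext => n /=; rewrite sumEFin.
have PD : P D = 1.
  rewrite measure_semi_bigcup//= -(eE _ _ p1); apply: eq_eseriesr => k _.
  exact: Xp.
have PDc : P (~` D) = 0 by rewrite probability_setC// PD subee.
rewrite -(setUv D) ge0_integral_setU//; last 3 first.
- exact: measurableC.
- exact: measurable_funTS.
- by rewrite disj_set2E setICr.
rewrite [X in _ + X]null_set_integral//; last 2 first.
- exact: measurableC.
- exact: measurable_funTS.
rewrite adde0 ge0_integral_bigcup//; last exact: measurable_funTS.
rewrite -(eE _ _ hl); apply: eq_eseriesr => k _.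
rewrite (eq_integral (cst (h k%:R)%:E)); last by move=> w; rewrite inE /F/= => ->.
by rewrite integral_cst// EFinM -Xp.
Qed.

End IndependentIntegrals.

(** * The Laplace transform of a Levy process as a function of time *)

Section LaplaceExponentOfLevyProcess.
Context d (T : measurableType d) (R : realType) (P : probability T R).
Variables (X : R -> {RV P >-> R}) (lambda l : R).
Hypotheses (X_levy : levy_process X) (lambda0 : 0 <= lambda).
Local Open Scope ereal_scope.
Let e (x : R) : \bar R := (expR (- (lambda * x)))%:E.
Let phi (t : R) : \bar R := \int[P]_w e (X t w).

Let e_ge0 x : 0 <= e x. Proof. by rewrite lee_fin expR_ge0. Qed.

Let me_ : measurable_fun [set: R] e.
Proof.
apply/measurable_EFinP; apply: measurableT_comp => //.
by apply: measurableT_comp => //; exact: measurable_funM.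
Qed.

Let mincr s t : measurable_fun [set: T] (fun w => (X s w - X t w)%R).
Proof. exact: measurable_funB. Qed.

Let phi_incr s t : (0 <= s)%R -> (0 <= t)%R ->
  phi t = \int[P]_w e (X (s + t)%R w - X s w)%R.
Proof.
move=> s0 t0; apply/esym; apply: ge0_integral_eq_law => //.
by move=> B mB; exact: (levy_stationary_increments X_levy s0 t0 mB).
Qed.

Let phi0 : phi 0%R = 1.
Proof.
rewrite (@phi_incr 0%R 0%R)// addr0.
rewrite (eq_integral (cst 1)); last first.
  by move=> w _; rewrite /e subrr mulr0 oppr0 expR0.
by rewrite integral_cst//= mul1e; exact: probability_setT.
Qed.

Let phiD s t : (0 <= s)%R -> (0 <= t)%R -> phi (s + t)%R = phi s * phi t.
Proof.
move=> s0 t0; rewrite (@phi_incr 0%R (s + t)%R) ?addr_ge0// add0r.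
rewrite (@phi_incr 0%R s)// add0r (@phi_incr s t)//.
rewrite -ge0_integral_indep//.
  apply: eq_integral => w _; rewrite /e -EFinM -expRD; congr (expR _)%:E; ring.
(* The times 0, s, s + t, constant afterwards because monotonicity is asked of the whole
   sequence. *)
pose times (n : nat) : R := nth (s + t)%R [:: 0%R; s] n.
have times_homo : {homo times : i j / (i <= j)%N >-> (i <= j)%R}.
  move=> [|[|i]] [|[|j]]//= _; rewrite /times/= ?nth_nil ?addr_ge0 ?lerDl//.
have := levy_independent_increments X_levy (n := 2) (t := times) (lexx _) times_homo.
move=> ind A B mA mB.
have mAB (i : 'I_2) : measurable (if i == ord0 then A else B) by case: ifP.
have := ind _ mAB; rewrite !big_ord_recl big_ord0 mulr1/=.
set U := \bigcap_(i in _) _.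
have -> : U = (fun w => X s w - X 0 w)%R @^-1` A `&`
              (fun w => X (s + t) w - X s w)%R @^-1` B.
  apply/seteqP; split=> [w Uw|w [Aw Bw] i _].
    by split; [exact: (Uw ord0)|exact: (Uw (lift ord0 ord0))].
  by case: i => -[|[|//]] iP; [exact: Aw|exact: Bw].
set a := P _; set b := P _; set c := P _ => E.
have fin : forall Z, measurable Z -> P Z \is a fin_num by move=> Z mZ; exact: fin_num_measure.
have mA' : measurable ((fun w => X s w - X 0 w)%R @^-1` A).
  by rewrite -[_ @^-1` _]setTI; exact: mincr.
have mB' : measurable ((fun w => X (s + t) w - X s w)%R @^-1` B).
  by rewrite -[_ @^-1` _]setTI; exact: mincr.
have fa : a \is a fin_num by apply: fin; exact: measurableI.
have fb : b \is a fin_num by apply: fin.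
have fc : c \is a fin_num by apply: fin.
by rewrite -(fineK fa) E EFinM !fineK.
Qed.

Let mjump s : measurable [set w | (1 < `|X s w - X 0%R w|)%R].
Proof.
rewrite (_ : [set w | _] = (fun w => `|X s w - X 0%R w|)%R @^-1` [set` `]1%R, +oo[%R]).
  rewrite -[_ @^-1` _]setTI; apply: measurableT_comp => //; exact: mincr.
by apply/seteqP; split=> w /=; rewrite in_itv/= andbT.
Qed.

Let near0 : exists2 delta, (0 < delta)%R & forall s, (0 <= s)%R -> (s <= delta)%R ->
  P [set w | (1 < `|X s w - X 0%R w|)%R] <= 2^-1%:E.
Proof.
have := levy_stochastic_continuity X_levy (lexx 0%R) (@ltr01 R).
move=> /fine_cvgP[_ /cvgrPdist_lt/(_ 2^-1%R)].
rewrite invr_gt0 ltr0n => /(_ isT)[r /= r0 rP].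
(* Half the radius, so that [s <= delta] implies membership in the open ball. *)
exists (r / 2)%R; first by rewrite divr_gt0.
move=> s s0 sr; have := rP s; rewrite /ball/= sub0r normrN ger0_norm// => /(_ _ s0).
rewrite sub0r normrN => h.
have mS : measurable [set w | (1 < `|X s w - X 0%R w|)%R].
  exact: mjump.
rewrite -(fineK (fin_num_measure P _ mS)) lee_fin.
apply: le_trans (ler_norm _) _; apply/ltW/h.
by apply: le_lt_trans sr _; rewrite ltr_pdivrMr// ltr_pMr// ltr1n.
Qed.

(** With probability at least 1/2 the increment from time 0 is at most 1, and there the integrand is
    at least exp(-lambda). *)
Let phi_ge : exists delta, (0 < delta)%R /\ forall s, (0 <= s)%R -> (s <= delta)%R ->
  (expR (- lambda) / 2)%:E <= phi s.
Proof.
have [delta d0 dP] := near0; exists delta; split=> // s s0 sd.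
pose S := [set w | (1 < `|X s w - X 0%R w|)%R].
have mS : measurable S.
  exact: mjump.
have PSc : 2^-1%:E <= P (~` S).
  have := dP s s0 sd; rewrite -/S probability_setC//.
  have := fin_num_measure P _ mS; case: (P S) => //= x _.
  by rewrite -EFinB !lee_fin => ?; lra.
rewrite (@phi_incr 0%R s)// add0r.
apply: (@le_trans _ _ (\int[P]_(w in ~` S) e (X s w - X 0%R w)%R)); last first.
  apply: ge0_subset_integral => //; first exact: measurableC.
  exact: measurableT_comp me_ (mincr _ _).
apply: (@le_trans _ _ (\int[P]_(w in ~` S) cst (expR (- lambda))%:E w)).
  rewrite integral_cst; last exact: measurableC.
  rewrite EFinM lee_pmul2l ?lte_fin ?expR_gt0//.
apply: ge0_le_integral => //.
- exact: measurableC.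
- by move=> w _; rewrite lee_fin expR_ge0.
- by apply: measurable_funTS; exact: measurableT_comp me_ (mincr _ _).
move=> w /= /negP; rewrite -leNgt => Sw; rewrite lee_fin ler_expR lerN2.
by rewrite ler_piMr// (le_trans (ler_norm _)).
Qed.

Lemma levy_laplaceE : 'E_P[fun w => expR (- (lambda * X 1%R w))] = (expR (- l))%:E ->
  forall t, (0 <= t)%R ->
  'E_P[fun w => expR (- (lambda * X t w))] = (expR (- (t * l)))%:E.
Proof.
rewrite unlock => phi1 t t0; have [delta [d0 dP]] := phi_ge.
apply: (multiplicative_expR (phi := phi) phiD phi0 phi1 d0 _ dP t0).
by rewrite divr_gt0 ?expR_gt0.
Qed.

End LaplaceExponentOfLevyProcess.

(** * The logarithmic law and the limit of its exponent *)

Section GPositivity.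
Variable R : realType.
Variables (alpha x : R).
Hypotheses (ax0 : 0 <= alpha * x) (ax1 : alpha * x < 1).

Lemma cvg_one_plus_G :
  series (fun n => (alpha * x) ^+ n / n.+1%:R) @ \oo --> 1 + G alpha x.
Proof. by rewrite (one_plus_G (cvg_hcoef ax0 ax1)); exact: cvg_hcoef. Qed.

Lemma one_plus_G_gt0 : 0 < 1 + G alpha x.
Proof.
apply: (@lt_le_trans _ _ 1) => //.
have := cvg_one_plus_G; rewrite -cvg_shiftS => /cvgr_to_ge; apply.
apply: nearW => n; rewrite /series/= big_nat_recl//= expr0 divr1 lerDl.
by apply: sumr_ge0 => i _; rewrite divr_ge0// exprn_ge0.
Qed.

End GPositivity.

Section LogarithmicLevyProcess.
Context (R : realType) (alpha : R) (alpha_gt0 : 0 < alpha) (alpha_lt1 : alpha < 1).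
Let A := - ln (1 - alpha).
Let F x := 1 + G alpha x.

Let F1 : F 1 = A / alpha.
Proof. exact: one_plus_G_at1. Qed.

Let alpha_mul01 x : 0 <= x -> x <= 1 -> 0 <= alpha * x < 1.
Proof.
move=> x0 x1; rewrite mulr_ge0 ?(ltW alpha_gt0)//=.
by apply: le_lt_trans alpha_lt1; rewrite ler_piMr// ltW.
Qed.

Let F_gt0 x : 0 <= x -> x <= 1 -> 0 < F x.
Proof. by move=> x0 x1; have /andP[? ?] := alpha_mul01 x0 x1; exact: one_plus_G_gt0. Qed.

Let exp01 (lambda : R) : 0 <= lambda -> 0 <= expR (- lambda) <= 1.
Proof. by move=> l0; rewrite expR_ge0 -expR0 ler_expR oppr_le0. Qed.

(** This is 1 - alpha < exp(-alpha). It makes theta = ln(A / alpha) positive, so that dividing by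
    theta is legitimate. *)
Lemma logarithmic_lt : alpha < A.
Proof.
rewrite ltrNr -ltr_expR lnK ?posrE ?subr_gt0//.
by apply: expR_gt1Dx; rewrite oppr_eq0 gt_eqF.
Qed.

Let A_gt0 : 0 < A. Proof. exact: lt_trans logarithmic_lt. Qed.

(** As F(1) = A / alpha, the masses are alpha^k / ((k+1) F(1)), with generating function F(x) /
    F(1). At x = 1 this shows that they sum to 1; at x = exp(-lambda) it is the transform. *)
Lemma laplace_logarithmic d (T : measurableType d) (P : probability T R)
    (X : {RV P >-> R}) (lambda : R) :
  (forall k : nat, P (X @^-1` [set k%:R]) = (A^-1 * (alpha ^+ k.+1 / k.+1%:R))%:E) ->
  0 <= lambda ->
  ('E_P[fun w => expR (- (lambda * X w))] =
    (expR (- (ln (F 1) - ln (F (expR (- lambda))))))%:E)%E.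
Proof.
move=> Xlaw l0; have /andP[e0 e1] := exp01 l0; rewrite unlock.
have sumE x : 0 <= x -> x <= 1 ->
    series (fun k => x ^+ k * (A^-1 * (alpha ^+ k.+1 / k.+1%:R))) @ \oo -->
    (F 1)^-1 * F x.
  move=> x0 x1; have /andP[ax0 ax1] := alpha_mul01 x0 x1.
  rewrite (_ : series _ = (F 1)^-1 *: series (fun n => (alpha * x) ^+ n / n.+1%:R)).
    by apply: cvgZr; exact: cvg_one_plus_G.
  rewrite -seriesZ; congr series; apply/funext => k.
  rewrite !fctE /GRing.scale/= F1 exprMn exprS; field.
  by rewrite nat1r pnatr_eq0 !gt_eqF.
apply: (integral_nat_valued (p := fun k => A^-1 * (alpha ^+ k.+1 / k.+1%:R))
  (h := fun x => expR (- (lambda * x)))) => //.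
- rewrite [X in _ --> X](_ : _ = (F 1)^-1 * F 1); last by rewrite mulVf// gt_eqF// F_gt0.
  rewrite (_ : (fun k => _) = fun k => 1 ^+ k * (A^-1 * (alpha ^+ k.+1 / k.+1%:R))).
    exact: sumE.
  by apply/funext => k; rewrite expr1n mul1r.
- apply: measurableT_comp => //.
  by apply: measurableT_comp => //; exact: measurable_funM.
- rewrite [X in _ --> X](_ : _ = (F 1)^-1 * F (expR (- lambda))); last first.
    by rewrite opprB expRD (expRN (ln (F 1))) !lnK ?posrE ?F_gt0// mulrC.
  rewrite (_ : (fun k => _) = fun k =>
    expR (- lambda) ^+ k * (A^-1 * (alpha ^+ k.+1 / k.+1%:R))); first exact: sumE.
  by apply/funext => k; rewrite -mulNr expRM_natr.
Qed.

Lemma ln_F1_gt0 : 0 < ln (F 1).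
Proof. by rewrite ln_gt0// F1 ltr_pdivlMr// mul1r logarithmic_lt. Qed.

(** The series of ln F has nonnegative coefficients and starts at degree 1, where x^n <= x. This
    squeezes ln F(exp(-lambda)) to 0. *)
Lemma ln_F_ge0_le x : 0 <= x -> x <= 1 -> 0 <= ln (F x) <= x * ln (F 1).
Proof.
move=> x0 x1; have cx := cvg_hlog01 alpha_gt0 alpha_lt1 x0 x1.
have c1 := cvg_hlog01 alpha_gt0 alpha_lt1 ler01 (lexx 1).
have t0 n : 0 <= alpha ^+ n.+1 * hlog R n.+1.
  by rewrite mulr_ge0 ?hlog_ge0// exprn_ge0// ltW.
apply/andP; split.
  apply: (cvgr_to_ge cx); apply: nearW => n; apply: sumr_ge0 => i _.
  by rewrite mulr_ge0// exprn_ge0.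
have cx1 : (x : R) *: series (fun n => alpha ^+ n.+1 * hlog R n.+1 * 1 ^+ n.+1) @ \oo
  --> x * ln (F 1) by apply: cvgZr.
apply: (ler_cvg_to cx cx1).
apply: nearW => n; rewrite -seriesZ; apply: ler_sum => i _.
rewrite fctE /GRing.scale/= expr1n mulr1 mulrC ler_wpM2r//.
by rewrite exprS ler_piMr// exprn_ile1.
Qed.

Lemma cvg_ln_F : ln (F (expR (- lambda))) @[lambda --> +oo] --> (0 : R).
Proof.
apply: (@squeeze_cvgr _ _ _ _ (cst 0) (fun lambda => expR (- lambda) * ln (F 1))).
- near=> lambda; have l0 : 0 <= lambda by near: lambda; exact: nbhs_pinfty_ge.
  by have /andP[? ?] := exp01 l0; exact: ln_F_ge0_le.
- exact: cvg_cst.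
rewrite -[X in _ --> X](mul0r (ln (F 1))); apply: cvgM; last exact: cvg_cst.
exact: cvgr_expR.
Unshelve. all: by end_near. Qed.

End LogarithmicLevyProcess.

Theorem lemma2 (R : realType) (alpha : R) (alpha_gt0 : 0 < alpha)
    (alpha_lt1 : alpha < 1) (A : R) (A_def : A = - ln (1 - alpha))
    (d : measure_display) (T : measurableType d) (P : probability T R)
    (L : R -> {RV P >-> R}) (L_levy : levy_process L)
    (L_law : forall k : nat,
       P (L 1 @^-1` [set k%:R]) = (A^-1 * (alpha ^+ k.+1 / k.+1%:R))%:E) :
  let c := fun k : nat => k`!%:R / k.+1%:R : R in
  [/\ forall s : R[i], `|s| <= 1 ->
        hypergeometric2F1 1 1 2 (alpha%:C * s) = 1 + G alpha%:C s,
      exists psi : R -> R, exists Pi : nat -> R,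
        laplace_exponent L psi /\ levy_measure psi Pi
    & forall (psi : R -> R) (Pi : nat -> R),
        laplace_exponent L psi -> levy_measure psi Pi ->
        [/\ forall n : nat, (1 <= n)%N ->
              Pi n = alpha ^+ n / n`!%:R *
                \sum_(1 <= k < n.+1)
                  (-1) ^+ k.-1 * (k.-1)`!%:R * partial_bell n k c,
            forall s : R[i], `|s| <= 1 ->
              cvgn (series (gen_terms Pi s)) /\
              gen_function Pi s = Clog (1 + G alpha%:C s)
          & exists theta : R,
              [/\ total_mass Pi = theta%:E,
                  psi lambda @[lambda --> +oo] --> theta,
                  theta = - ln (alpha / A)
                & forall lambda : R, 0 <= lambda ->
                    psi lambda =
                      theta * (1 - theta^-1 *
                                 ln (1 + G alpha (expR (- lambda))))]]].
Proof.
move=> c.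
have s_lt1 (s : R[i]) : `|s| <= 1 -> normc (alpha%:C * s) < 1.
  rewrite complex_normE lecR ComplexField.Normc.normcM normc_real gtr0_norm// => s1.
  by apply: le_lt_trans alpha_lt1; rewrite ler_piMr// ltW.
pose psi0 (lambda : R) := ln (1 + G alpha 1) - ln (1 + G alpha (expR (- lambda))).
have psi0E (lambda : R) : 0 <= lambda ->
    ('E_P[fun w => expR (- (lambda * L 1%R w))%R])%E = (expR (- psi0 lambda))%:E.
  by move=> l0; apply: laplace_logarithmic => // k; rewrite L_law A_def.
split.
- by move=> s /s_lt1; exact: hypergeometric2F1_G.
- exists psi0, (fun n => alpha ^+ n * hlog R n); split.
    by move=> t lambda t0 l0; apply: (levy_laplaceE L_levy l0 (psi0E _ l0)).
  exact: levy_measure_hlog.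
move=> psi Pi psiL PiL.
(* Time 1 alone determines the exponent, by injectivity of [expR]. *)
have psiE lambda : 0 <= lambda ->
    psi lambda = ln (1 + G alpha 1) - ln (1 + G alpha (expR (- lambda))).
  move=> l0; have := psiL 1 lambda ler01 l0; rewrite psi0E// mul1r.
  by move=> [/expR_inj/oppr_inj].
have PiE := levy_measure_unique alpha_gt0 alpha_lt1 psiE PiL.
split.
(* [c] is k! times [hcoef], so the Bell sum in [log_coef] is already the one claimed. *)
- by move=> [|n]// _; rewrite PiE /hlog /log_coef mulrA.
- move=> s /s_lt1 s1; have sC := cvg_hlog_complex s1.
  have gE : gen_terms Pi s = fun n => s ^+ n.+1 * (alpha ^+ n.+1 * hlog R n.+1)%:C.
    by apply/funext => n; rewrite /gen_terms PiE.
  have {}sC : series (gen_terms Pi s) @ \oo -->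
      (Clog (1 + G alpha%:C s) : (R[i] : numFieldType)) by rewrite gE.
  split; last exact: (cvg_lim (@norm_hausdorff _ _) sC).
  by apply/cvg_ex; exists (Clog (1 + G alpha%:C s)).
have theta_gt0 := ln_F1_gt0 alpha_gt0 alpha_lt1.
exists (ln (1 + G alpha 1)); split.
- apply: eseries_EFin_cvg.
  have := cvg_hlog01 alpha_gt0 alpha_lt1 ler01 (lexx 1).
  rewrite (_ : (fun n => _) = fun n => Pi n.+1)//.
  by apply/funext => n; rewrite PiE expr1n mulr1.
- have lim_psi : ln (1 + G alpha 1) - ln (1 + G alpha (expR (- lambda)))
      @[lambda --> +oo] --> ln (1 + G alpha 1).
    rewrite -[X in _ --> X]subr0.
    by apply: cvgB; [exact: cvg_cst|exact: cvg_ln_F].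
  apply: cvg_trans lim_psi; apply: near_eq_cvg; near=> lambda.
  by rewrite psiE//; near: lambda; exact: nbhs_pinfty_ge.
- have A_gt0 : 0 < A by rewrite A_def (lt_trans alpha_gt0)// logarithmic_lt.
  by rewrite one_plus_G_at1// -A_def -lnV ?invf_div// posrE divr_gt0.
move=> lambda l0; rewrite psiE// mulrBr mulr1 mulrA divff ?mul1r// gt_eqF//.
Unshelve. all: by end_near. Qed.
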